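(* Let $\mathbb{K}\in\{\mathbb{R},\mathbb{C}\}$ and let $f\in\mathbb{K}[x_1,\dots,x_n]$ be homogeneous of degree $3$. Consider the randomized algorithm: pick $R\in M_n(\mathbb{K})$ with random entries from a finite set, set $h(x)=f(Rx)$, compute the first three slices $T_1,T_2,T_3$ of $h$, reject if $T_1$ is singular, otherwise compute $T_1'=T_1^{-1}$ and accept iff $T_1'T_2$ and $T_1'T_3$ commute and $T_1'T_2$ is diagonalisable over $\mathbb{K}$. If $f$ is given in dense representation, this algorithm runs in time (number of arithmetic operations) $O(n^{\omega+1})$. If $f$ is given as a blackbox, the algorithm makes $O(n^2)$ calls to the blackbox and $O(n^{\omega+1})$ arithmetic operations.
   Context: $\omega$ is a feasible exponent of matrix multiplication. The $k$-th slice of a cubic form $g=\sum_{i,j,k}T_{ijk}x_ix_jx_k$ with $(T_{ijk})$ symmetric is the matrix $T_k=(T_{ijk})_{1\le i,j\le n}$. A blackbox for $f$ is an oracle returning $f(a)$ for any input point $a$. *)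

(* Defs.v *)
From HB Require Import structures.
From mathcomp Require Import all_boot all_order all_algebra.
From mathcomp Require Import complex boolp reals exp.
From mathcomp Require Import mpoly.

Set Implicit Arguments.
Unset Strict Implicit.
Unset Printing Implicit Defensive.

Import GRing.Theory Num.Theory.
Local Open Scope ring_scope.

Variant ground := GroundReal | GroundComplex.

Definition ground_field (R : realType) (k : ground) : numFieldType :=
  match k with GroundReal => R | GroundComplex => complex R end.

Definition ground_ordered (k : ground) : bool :=
  if k is GroundReal then true else false.

(** * Algebraic computation trees with random samples and an oracle *)

Variant operand (K I : Type) :=
  | Const of K
  | Input of I
  | Reg of nat.

Arguments Const {K I}.
Arguments Input {K I}.
Arguments Reg {K I}.

Variant arith_op := Add | Sub | Mul | Div.

(* [I] indexes the input scalars, [q] is the arity of the oracle and [O] the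
   type of leaves; leaves normally contain operands, to be read in the final
   memory. Each [Arith], [Sample] and [Query] appends one scalar to the memory;
   [Reg i] is the i-th scalar so appended. As usual for arithmetic complexity,
   an algorithm is a family of such trees, one for each size n. *)
Inductive prog (K I : Type) (q : nat) (O : Type) :=
  | Return of O
  | Arith of arith_op & operand K I & operand K I & prog K I q O
  | Sample of prog K I q O
  | Query of 'rV[operand K I]_q & prog K I q O
  | IfZero of operand K I & prog K I q O & prog K I q O
  | IfNonneg of operand K I & prog K I q O & prog K I q O.

Record machine (K I : Type) (q : nat) := Machine {
  input : I -> K;
  oracle : option ('rV[K]_q -> K);
  (* whether the sign test [IfNonneg] is available *)
  ordered : bool
}.

Record result (K O : Type) := Result {
  leaf : O;
  memory : seq K;
  ops : nat;
  calls : nat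
}.

Definition charge (K O : Type) (o c : nat) (r : result K O) : result K O :=
  Result (leaf r) (memory r) (o + ops r) (c + calls r).

Section Semantics.
Variables (K : numFieldType) (I : Type) (q : nat) (O : Type).

Definition value (inp : I -> K) (mem : seq K) (a : operand K I) : K :=
  match a with
  | Const c => c
  | Input i => inp i
  | Reg i => nth 0 mem i
  end.

Definition arith (o : arith_op) (x y : K) : option K :=
  match o with
  | Add => Some (x + y)
  | Sub => Some (x - y)
  | Mul => Some (x * y)
  | Div => if y == 0 then None else Some (x / y)
  end.

(* [tape] lists the outcomes of the successive samples. [None] is a failed run:
   division by 0, exhausted tape, missing oracle or unavailable sign test.
   Operations, tests and samples cost one unit of [ops]; oracle calls are
   counted in [calls]. *)
Fixpoint run (m : machine K I q) (p : prog K I q O) (mem tape : seq K) :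
    option (result K O) :=
  let val := value (input m) mem in
  match p with
  | Return o => Some (Result o mem 0 0)
  | Arith op a b p' =>
      if arith op (val a) (val b) is Some x
      then omap (charge 1 0) (run m p' (rcons mem x) tape) else None
  | Sample p' =>
      if tape is x :: tape'
      then omap (charge 1 0) (run m p' (rcons mem x) tape') else None
  | Query v p' =>
      if oracle m is Some g
      then omap (charge 0 1) (run m p' (rcons mem (g (map_mx val v))) tape)
      else None
  | IfZero a p1 p2 =>
      omap (charge 1 0) (if val a == 0 then run m p1 mem tape
                         else run m p2 mem tape)
  | IfNonneg a p1 p2 =>
      if ordered m
      then omap (charge 1 0) (if 0 <= val a then run m p1 mem tape
                              else run m p2 mem tape)
      else None
  end.

End Semantics.

(** * Matrix multiplication *)

Definition matmul_input (n : nat) : Type :=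
  (('I_n * 'I_n) + ('I_n * 'I_n))%type.

Definition matmul_machine (K : numFieldType) (ord : bool) (n : nat)
    (A B : 'M[K]_n) : machine K (matmul_input n) 0 :=
  Machine
    (fun i => match i with inl ij => A ij.1 ij.2 | inr ij => B ij.1 ij.2 end)
    None ord.

Definition feasible_exponent (R : realType) (K : numFieldType) (ord : bool)
    (w : R) : Prop :=
  exists C : R, forall n : nat,
  exists P : prog K (matmul_input n) 0 'M[operand K (matmul_input n)]_n,
  forall A B : 'M[K]_n,
  let m := matmul_machine ord A B in
  exists r, [/\ run m P [::] [::] = Some r,
    map_mx (value (input m) (memory r)) (leaf r) = A *m B
    & (ops r)%:R <= C * powR n%:R w].

(** * The randomized algorithm on cubic forms *)

Section Cubic.
Variables (K : numFieldType) (n : nat).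

Definition lin_subst (f : {mpoly K[n]}) (A : 'M[K]_n) : {mpoly K[n]} :=
  f \mPo [tuple \sum_(j < n) A i j *: 'X_j | i < n].

Definition symmetric_tensor (T : 'I_n -> 'I_n -> 'I_n -> K) : Prop :=
  forall i j k, T i j k = T j i k /\ T i j k = T i k j.

Definition tensor_of (g : {mpoly K[n]}) (T : 'I_n -> 'I_n -> 'I_n -> K) : Prop :=
  symmetric_tensor T /\
  g = \sum_(i < n) \sum_(j < n) \sum_(k < n) T i j k *: ('X_i * 'X_j * 'X_k).

Definition slice (T : 'I_n -> 'I_n -> 'I_n -> K) (k : 'I_n) : 'M[K]_n :=
  \matrix_(i, j) T i j k.

End Cubic.

(* [Singular T1 T2 T3] is a rejection, [Decided T1 T2 T3 T1' b] an acceptance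
   iff [b]. *)
Variant outcome (X : Type) (n : nat) :=
  | Singular of 'M[X]_n & 'M[X]_n & 'M[X]_n
  | Decided of 'M[X]_n & 'M[X]_n & 'M[X]_n & 'M[X]_n & bool.

Arguments Singular {X n}.
Arguments Decided {X n}.

Definition map_outcome (X Y : Type) (n : nat) (g : X -> Y) (o : outcome X n) :
    outcome Y n :=
  match o with
  | Singular A B C => Singular (map_mx g A) (map_mx g B) (map_mx g C)
  | Decided A B C D b =>
      Decided (map_mx g A) (map_mx g B) (map_mx g C) (map_mx g D) b
  end.

Section Algorithm.
Variables (K : numFieldType) (n : nat) (n_ge3 : (3 <= n)%N).

Definition decide (T1 T2 T3 : 'M[K]_n) : outcome K n :=
  if T1 \in unitmx then
    let T1' := invmx T1 in
    Decided T1 T2 T3 T1'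
      `[< comm_mx (T1' *m T2) (T1' *m T3) /\ diagonalizable (T1' *m T2) >]
  else Singular T1 T2 T3.

Definition algorithm_outcome (f : {mpoly K[n]}) (A : 'M[K]_n)
    (o : outcome K n) : Prop :=
  exists2 T, tensor_of (lin_subst f A) T &
    let S (k : 'I_3) := slice T (widen_ord n_ge3 k) in
    o = decide (S (@Ordinal 3 0 isT)) (S (@Ordinal 3 1 isT))
               (S (@Ordinal 3 2 isT)).

Definition sample_tape (A : 'M[K]_n) : seq K :=
  [seq A i j | i <- enum 'I_n, j <- enum 'I_n].

(* [P] executes the algorithm with at most [t] operations and [c] oracle calls,
   whatever the cubic form [f], the finite set [S] and the matrix drawn from it;
   [P] does not depend on these. *)
Definition implements (I : Type) (ord : bool) (inp : {mpoly K[n]} -> I -> K)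
    (orc : {mpoly K[n]} -> option ('rV[K]_n -> K))
    (P : prog K I n (outcome (operand K I) n))
    (R : realType) (t : R) (c : nat) : Prop :=
  forall f : {mpoly K[n]}, f \is 3.-homog ->
  forall (S : seq K) (A : 'M[K]_n), (forall i j, A i j \in S) ->
  exists r, [/\
    run (Machine (inp f) (orc f) ord) P [::] (sample_tape A) = Some r,
    algorithm_outcome f A (map_outcome (value (inp f) (memory r)) (leaf r)),
    (ops r)%:R <= t & (calls r <= c)%N].

Definition cubic_monom : Type := {m : 'X_{1..n} | mdeg m == 3}.

Definition dense_input (f : {mpoly K[n]}) (m : cubic_monom) : K := f@_(val m).

Definition no_input (f : {mpoly K[n]}) (e : void) : K := match e with end.

Definition blackbox (f : {mpoly K[n]}) (a : 'rV[K]_n) : K :=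
  f.@[fun i => a 0 i].

End Algorithm.

(* Main.v *)
(** All steps cost O(n^3) operations plus O(n) matrix products. This is within
    O(n^(omega+1)), because a program multiplying n x n matrices has to read
    every entry of its left factor, so that n^2 <= 2 M(n) where M(n) is its cost.

    The slices of f(Rx) are congruent to combinations of the slices of f (dense
    input), or follow from polarization with four values of f per entry
    (blackbox). T_1 is inverted by elimination. Diagonalisability of A is decided
    with the trace form <p, g> = tr (p(A) g(A)).

    Over the complex numbers, the first linear dependence between the columns
    of the Hankel matrix (tr A^(i+j)) gives the radical of the characteristic
    polynomial, and A is diagonalisable iff the radical annihilates A; if there
    is no dependence then the eigenvalues are distinct.

    Over the reals, A is diagonalisable iff the trace form is positive definite
    on R[A]. The orthogonal polynomials p_k of this form satisfy a three-term
    recurrence, so that each p_k(A) costs one product; the test accepts when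
    p_k(A) = 0 and rejects when p_k(A) <> 0 and <p_k, p_k> <= 0. In the first
    case p_k has simple real roots: if p_k = ((X - a)^2 + c^2) g then
    0 = <p_k, g> = <(X - a) g, (X - a) g> + c^2 <g, g> > 0. *)

Require Import Defs.
From mathcomp Require Import all_boot all_order all_algebra.
From mathcomp Require Import complex boolp reals exp.
From mathcomp Require Import mpoly zify ring.
Set Implicit Arguments.
Unset Strict Implicit.
Unset Printing Implicit Defensive.

Import Order.TTheory GRing.Theory Num.Theory.
Local Open Scope ring_scope.

(** * Traces and diagonalisability *)

Section TrigonalTrace.
Variables (F : fieldType) (n : nat).
Implicit Types A B : 'M[F]_n.+1.

Lemma trig_mulmx_diag A B : is_trig_mx A -> is_trig_mx B ->
  is_trig_mx (A *m B) /\ forall i, (A *m B) i i = A i i * B i i.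
Proof.
move=> /is_trig_mxP tA /is_trig_mxP tB; split=> [|i].
  apply/is_trig_mxP => i j ij; rewrite mxE big1 // => l _.
  have [il|li] := ltnP i l; first by rewrite tA ?mul0r.
  by rewrite tB ?mulr0 // (leq_ltn_trans li).
rewrite mxE (bigD1 i) //= big1 ?addr0 // => l /negP li.
have [il|{}il] := ltnP i l; first by rewrite tA ?mul0r.
by rewrite tB ?mulr0 // ltn_neqAle il andbT; apply/negP.
Qed.

Lemma trig_horner_mx_diag A (g : {poly F}) : is_trig_mx A ->
  is_trig_mx (horner_mx A g) /\ forall i, horner_mx A g i i = g.[A i i].
Proof.
move=> tA; elim/poly_ind: g => [|g c [tg IH]].
  by rewrite rmorph0; split=> [|i]; rewrite ?mx0_is_trig // mxE horner0.
rewrite rmorphD rmorphM /= horner_mx_X horner_mx_C -mulmxE.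
have [tgA dgA] := trig_mulmx_diag tg tA; split=> [|i]; last first.
  by rewrite mxE dgA IH !mxE eqxx mulr1n !hornerE.
move/is_trig_mxP: tgA => tgA; apply/is_trig_mxP => i j ij.
by rewrite mxE tgA // add0r !mxE -val_eqE /= ltn_eqF.
Qed.

End TrigonalTrace.

(** Schur's theorem makes [A] similar to a triangular [T]. The family [d] is the diagonal of [T],
    that is, the eigenvalues with multiplicity, and g(T) has the values of g at these points on its
    diagonal. *)
Lemma mxtrace_horner_eigen (C : numClosedFieldType) n (A : 'M[C]_n.+1) :
  exists d : 'I_n.+1 -> C, char_poly A = \prod_i ('X - (d i)%:P) /\
    forall g, \tr (horner_mx A g) = \sum_i g.[d i].
Proof.
have [P /unitarymx_unit Pu] := @Schur C _ A isT.
rewrite /similar_to conjumx // => tT; set T := P *m A *m invmx P in tT.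
have defA : A = invmx P *m T *m P by rewrite !mulmxA mulVmx // mul1mx mulmxKV.
exists (fun i => T i i); split=> [|g].
  rewrite -char_poly_trig // /char_poly /char_poly_mx.
  pose Q := map_mx polyC P; have Qu : map_mx polyC (invmx P) *m Q = 1%:M.
    by rewrite -map_mxM mulVmx // map_mx1.
  have -> : 'X%:M - map_mx polyC A =
      map_mx polyC (invmx P) *m ('X%:M - map_mx polyC T) *m Q.
    rewrite mulmxBr mulmxBl -!map_mxM -defA; congr (_ - _).
    by rewrite -mulmxA -scalar_mxC mulmxA Qu mul1mx.
  by rewrite !det_mulmx mulrAC -det_mulmx Qu det1 mul1r.
have [_ dg] := trig_horner_mx_diag g tT.
rewrite -(eq_bigr _ (fun i _ => dg i)) -/(\tr _).
by rewrite /T horner_mx_uconj // mxtrace_mulC mulmxA mulVmx // mul1mx.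
Qed.

(** * Moments of a matrix over an algebraically closed field *)

Section ComplexDiag.
Variables (C : numClosedFieldType) (n : nat) (A : 'M[C]_n.+1).

(** By Cayley-Hamilton, [g] may be reduced modulo the characteristic polynomial, which leaves a
    combination of the powers covered by the hypothesis. *)
Lemma mxtrace_horner_eq0 q :
  (forall i : 'I_n.+1, \tr (A ^+ i *m horner_mx A q) = 0) ->
  forall g, \tr (horner_mx A (g * q)) = 0.
Proof.
move=> q0 g; have -> : horner_mx A (g * q) = horner_mx A (g %% char_poly A * q).
  rewrite {1}(divp_eq g (char_poly A)) !rmorphM rmorphD rmorphM /=.
  by rewrite Cayley_Hamilton mulr0 add0r.
have sg : (size (g %% char_poly A)%R <= n.+1)%N.
  by rewrite -ltnS -[n.+2](size_char_poly A) ltn_modp monic_neq0 ?char_poly_monic.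
move: (g %% _) sg => {}g sg; rewrite -(coefK g) poly_def.
rewrite -[LHS]/(\tr _) mulr_suml !raddf_sum /= big1 // => i _.
rewrite -scalerAl linearZ /= rmorphM /= rmorphXn /= horner_mx_X mxtraceZ.
by rewrite -[i : nat]/(widen_ord sg i : nat) q0 mulr0.
Qed.

(* The columns of the Hankel matrix [tr A^(i+j)] are the moments of the powers
   of 'X; the polynomials with zero moments are the multiples of the radical
   of the characteristic polynomial. *)
Lemma diagonalizable_hankel_dep (q : {poly C}) :
  (forall i : 'I_n.+1, \tr (A ^+ i *m horner_mx A q) = 0) ->
  q != 0 ->
  (forall g : {poly C}, g != 0 -> (size g < size q)%N ->
     exists i : 'I_n.+1, \tr (A ^+ i *m horner_mx A g) != 0) ->
  diagonalizable A <-> horner_mx A q = 0.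
Proof.
move=> q0 nzq qmin; have [d [pd trd]] := mxtrace_horner_eigen A.
pose rs := undup (codom d); pose r := \prod_(x <- rs) ('X - x%:P).
have urs : uniq rs by rewrite undup_uniq.
have rd i : root r (d i) by rewrite root_prod_XsubC mem_undup codom_f.
have qroot i : root q (d i).
  (* This test polynomial vanishes at every eigenvalue except [d i], so the trace is the
     multiplicity of [d i] times [g.[d i] * q.[d i]]. In characteristic zero only [q.[d i]] can
     vanish. *)
  have := mxtrace_horner_eq0 q0 (\prod_(x <- rs | x != d i) ('X - x%:P)).
  rewrite trd; set g := \prod_(x <- _ | _) _.
  have g0 j : d j != d i -> g.[d j] = 0.
    move=> dji; apply/eqP; rewrite horner_prod prodf_seq_eq0; apply/hasP.
    by exists (d j); rewrite ?mem_undup ?codom_f // dji !hornerE subrr eqxx.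
  rewrite (bigID (fun j => d j == d i)) /= [X in _ + X]big1 ?addr0; last first.
    by move=> j dji; rewrite hornerM g0 ?mul0r.
  rewrite (eq_bigr (fun=> g.[d i] * q.[d i])); last first.
    by move=> j /eqP ->; rewrite hornerM.
  rewrite sumr_const => /eqP; rewrite mulrn_eq0 mulf_eq0.
  case/or3P=> [/eqP/card0_eq/(_ i)| |//]; first by rewrite -[_ \in _]/(d i == d i) eqxx.
  rewrite horner_prod prodf_seq_eq0 => /hasP[x _].
  by rewrite !hornerE subr_eq0 eq_sym => /andP[/negPf ->].
split=> [[P Pu dP]|qA0].
  (* The minimal polynomial of a diagonalisable matrix has simple roots, and each of them is an
     eigenvalue, hence a root of [q]. *)
  apply/mxminpoly_minP; rewrite (similar_diag_mxminpoly Pu dP).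
  apply: uniq_roots_dvdp; last by rewrite uniq_rootsE undup_uniq.
  apply/allP => x xs; suff: root (mxminpoly A) x.
    rewrite root_mxminpoly pd /root horner_prod => /prodf_eq0[i _].
    by rewrite !hornerE subr_eq0 => /eqP ->; apply: qroot.
  by rewrite (similar_diag_mxminpoly Pu dP) root_prod_XsubC.
have rq : r %| q.
  apply: uniq_roots_dvdp; last by rewrite uniq_rootsE.
  by apply/allP => x; rewrite mem_undup => /codomP[i ->].
apply/diagonalizableP; exists rs => //.
suff: q %| r by apply: dvdp_trans; apply: mxminpoly_min.
(* If [r] were smaller than [q], it would contradict [qmin]: its moments are zero because it
   vanishes at every eigenvalue. *)
suff: r %= q by rewrite /eqp => /andP[].
rewrite -(dvdp_size_eqp rq) eqn_leq dvdp_leq //= leqNgt; apply/negP => srq.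
have [|i] := qmin r _ srq; first by rewrite monic_neq0 // monic_prod_XsubC.
suff -> : A ^+ i *m horner_mx A r = horner_mx A ('X^i * r).
  rewrite trd big1 ?eqxx // => j _.
  by rewrite hornerM (rootP (rd j)) mulr0.
by rewrite rmorphM rmorphXn /= horner_mx_X.
Qed.

(** The radical of the characteristic polynomial has zero moments, so the hypothesis forces its
    degree up to [n.+1]: the eigenvalues are distinct. *)
Lemma diagonalizable_hankel_free :
  (forall g : {poly C}, g != 0 -> (size g <= n.+1)%N ->
     exists i : 'I_n.+1, \tr (A ^+ i *m horner_mx A g) != 0) ->
  diagonalizable A.
Proof.
move=> free; have [d [pd trd]] := mxtrace_horner_eigen A.
apply/diagonalizableP; exists (codom d); last first.
  by rewrite big_image /= -pd mxminpoly_dvd_char.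
pose r := \prod_(x <- undup (codom d)) ('X - x%:P).
case: (leqP (size r) n.+1) => [sr|].
  have [|i] := free r _ sr; first by rewrite monic_neq0 // monic_prod_XsubC.
  have -> : A ^+ i *m horner_mx A r = horner_mx A ('X^i * r).
    by rewrite rmorphM rmorphXn /= horner_mx_X.
  rewrite trd big1 ?eqxx // => j _; apply/eqP; rewrite hornerM mulf_eq0.
  by apply/orP; right; rewrite -[_ == _]/(root r _) root_prod_XsubC mem_undup codom_f.
rewrite size_prod_XsubC ltnS => sr; rewrite -[uniq _]negbK -ltn_size_undup.
by rewrite -leqNgt size_codom card_ord.
Qed.

End ComplexDiag.

(** * The trace form over a real closed field and its orthogonal polynomials *)

Section RealDiag.
Variables (R : rcfType) (n : nat) (A : 'M[R]_n.+1).
Implicit Types p g : {poly R}.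

Definition trace_form p g : R := \tr (horner_mx A (p * g)).

Lemma trace_formC p g : trace_form p g = trace_form g p.
Proof. by rewrite /trace_form mulrC. Qed.

Lemma trace_formDl p1 p2 g :
  trace_form (p1 + p2) g = trace_form p1 g + trace_form p2 g.
Proof. by rewrite /trace_form mulrDl rmorphD raddfD. Qed.

Lemma trace_formZl c p g : trace_form (c *: p) g = c * trace_form p g.
Proof. by rewrite /trace_form -scalerAl linearZ mxtraceZ. Qed.

Lemma trace_formMl p1 p2 g : trace_form (p1 * p2) g = trace_form p2 (p1 * g).
Proof. by rewrite /trace_form mulrCA mulrA. Qed.

Definition orth_poly k p :=
  [/\ p \is monic, size p = k.+1 &
      forall g, (size g <= k)%N -> trace_form p g = 0].

Definition form_pos k :=
  forall g, g != 0 -> (size g <= k)%N -> 0 < trace_form g g.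

(* Setting p = 0 and h = 1 for k = 0 starts the recurrence. *)
Definition orth_prev k p h :=
  if k is k'.+1 then orth_poly k' p /\ h = trace_form p p
  else p = 0 /\ h = 1.

Lemma orth_split k p g : orth_poly k p -> (size g <= k.+1)%N ->
  exists2 g' : {poly R}, (size g' <= k)%N & g = g`_k *: p + g'.
Proof.
case=> pm sp _ sg; exists (g - g`_k *: p); last by rewrite addrC subrK.
apply/leq_sizeP => j; rewrite leq_eqVlt => /orP[/eqP <-|kj].
  by rewrite coefB coefZ -[p`_k]/(p`_k.+1.-1) -sp -lead_coefE (monicP pm) mulr1 subrr.
rewrite coefB coefZ [p`_j]nth_default ?sp // mulr0 subr0.
by rewrite nth_default // (leq_trans sg).
Qed.

Lemma form_ge0 k g : form_pos k -> (size g <= k)%N -> 0 <= trace_form g g.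
Proof.
move=> pos sg; have [->|nz] := eqVneq g 0; last exact/ltW/pos.
by rewrite /trace_form mul0r rmorph0 linear0.
Qed.

(** Orthogonal splitting along [p]: if [g = c *: p + g'] with [g'] of degree below [k], then <g, g>
    = c^2 <p, p> + <g', g'>. *)
Lemma form_posS k p : form_pos k -> orth_poly k p -> 0 < trace_form p p ->
  form_pos k.+1.
Proof.
move=> pos op hp g nzg sg; have [g' sg' defg] := orth_split op sg.
have [_ _ /(_ _ sg') pg'] := op.
have -> : trace_form g g = g`_k ^+ 2 * trace_form p p + trace_form g' g'.
  rewrite {1 2}defg trace_formDl trace_formZl ![trace_form _ (_ + _)]trace_formC.
  by rewrite !trace_formDl !trace_formZl (trace_formC g' p) pg'; ring.
have [c0|c0] := eqVneq g`_k 0; last first.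
  by rewrite ltr_pwDl ?(form_ge0 pos) // mulr_gt0 // exprn_even_gt0.
rewrite c0 expr0n mul0r add0r; apply: pos => //.
by move: nzg; rewrite {1}defg c0 scale0r add0r.
Qed.

(* The three-term recurrence of orthogonal polynomials. *)
Lemma orth_polyS k p p' h' :
  form_pos k -> orth_poly k p -> 0 < trace_form p p -> orth_prev k p' h' ->
  h' != 0 ->
  orth_poly k.+1 (('X - (trace_form ('X * p) p / trace_form p p)%:P) * p -
                  (trace_form p p / h') *: p').
Proof.
move=> pos op hp prev h'0; set h := trace_form p p; set al := _ / h.
have [pm sp orp] := op.
have sp' : (size p' <= k)%N.
  case: k prev {pos op sp orp} => [[-> _]|k [[_ -> _] _]] //.
  by rewrite size_poly0.
have sq : size (('X - al%:P) * p) = k.+2.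
  by rewrite size_Mmonic ?polyXsubC_eq0 // size_XsubC sp.
have sbp' : (size (- (h / h' *: p')) < k.+2)%N.
  by rewrite size_polyN (leq_ltn_trans (size_scale_leq _ _)) // ltnS leqW.
split.
- rewrite monicE lead_coefDl ?sq // lead_coefM lead_coefXsubC mul1r.
  exact: pm.
- by rewrite size_polyDl ?sq.
move=> g sg; have [g' sg' ->] := orth_split op sg.
set b := h / h'.
have pp' : trace_form p p' = 0 by apply: orp.
rewrite trace_formC trace_formDl trace_formZl.
(* By linearity it suffices to pair with [p], where [al] makes the terms cancel, and with [g'], of
   degree below [k], where [b] does. *)
suff [-> ->] : trace_form p (('X - al%:P) * p - b *: p') = 0 /\
               trace_form g' (('X - al%:P) * p - b *: p') = 0.
  by rewrite mulr0 addr0.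
rewrite ![trace_form _ (_ - _)]trace_formC -!scaleNr !trace_formDl !trace_formZl.
split.
  rewrite (trace_formC p') pp' mulr0 addr0 mulrBl trace_formDl -mulNr -polyCN.
  by rewrite mul_polyC trace_formZl -/h /al mulNr mulrVK ?subrr // unitfE gt_eqF.
rewrite trace_formMl.
case: k prev op pos sp orp sg sg' sp' sq sbp' => [|k].
  case=> -> _ _ _ _ _ _; rewrite leqn0 size_poly_eq0 => /eqP -> *.
  by rewrite mulr0 /trace_form !mulr0 rmorph0 linear0 mulr0 addr0.
case=> op' eh' op _ sp orp _ sg' _ _ _.
have sXg' : (size (('X - al%:P) * g')%R <= k.+2)%N.
  have [->|nz] := eqVneq g' 0; first by rewrite mulr0 size_poly0.
  by rewrite size_monicM ?monicXsubC // size_XsubC.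
(* The factor ['X - al%:P] has been moved onto [g']. Of the resulting polynomial only the
   coefficient at the degree of [p] pairs with [p]. It is the top coefficient of [g'], which is also
   what the pairing of [g'] with [p'] sees, with weight [h'] instead of [h]. *)
have [g1 sg1 ->] := orth_split op sXg'.
have [g2 sg2 eg2] := orth_split op' sg'.
rewrite trace_formC trace_formDl trace_formZl (trace_formC g1) (orp g1) // addr0 -/h.
rewrite [in trace_form p' _]eg2 (trace_formC p') trace_formDl trace_formZl -eh'.
have [_ _ orp'] := op'; rewrite (trace_formC g2) (orp' g2) // addr0.
rewrite mulrBl coefB coefXM /= coefCM [g'`_k.+1]nth_default // mulr0 subr0.
by rewrite /b; field.
Qed.

(** Pairing with [g], whose degree is lower by two, gives a positive number where orthogonality
    gives 0. A nonzero [c] excludes a pair of conjugate roots, and [c = 0] excludes a double real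
    root. *)
Lemma orth_poly_no_quad k p a c g : form_pos k -> orth_poly k p ->
  p <> (('X - a%:P) ^+ 2 + (c ^+ 2)%:P) * g.
Proof.
move=> pos [pm sp orp] defp.
have nzg : g != 0.
  by apply: contraTneq pm => g0; rewrite defp g0 mulr0 monicE lead_coef0 eq_sym oner_eq0.
have sq : size (('X - a%:P) ^+ 2 + (c ^+ 2)%:P) = 3%N.
  rewrite size_polyDl; rewrite size_exp_XsubC //.
  by rewrite (leq_ltn_trans (size_polyC_leq1 _)).
have sg : (size g).+1 = k.
  by have := sp; rewrite defp size_proper_mul ?sq ?mulf_neq0 ?lead_coef_eq0 //
      -?size_poly_eq0 ?sq // => -[].
have := orp g; rewrite -sg leqnSn => /(_ isT).
rewrite defp mulrDl trace_formDl mul_polyC trace_formZl => e.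
have : 0 < trace_form (('X - a%:P) ^+ 2 * g) g + c ^+ 2 * trace_form g g.
  have g_ge0 : 0 <= c ^+ 2 * trace_form g g.
    by rewrite mulr_ge0 ?sqr_ge0 // (form_ge0 pos) // -sg.
  apply: ltr_wpDr g_ge0 _.
  rewrite expr2 -mulrA trace_formMl; apply: pos.
    by rewrite mulf_neq0 // polyXsubC_eq0.
  by rewrite size_monicM ?monicXsubC // size_XsubC -sg.
by rewrite e ltxx.
Qed.

Lemma orth_poly_split k p : form_pos k -> orth_poly k p ->
  exists2 rs, uniq rs & p = \prod_(x <- rs) ('X - x%:P).
Proof.
move=> pos op; have [pm _ _] := op.
pose pc := map_poly (real_complex R) p.
have [zs defpc] := closed_field_poly_normal pc.
have zreal z : z \in zs -> z = real_complex R (complex.Re z).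
  move=> zin; have rz : root pc z.
    rewrite defpc rootZ ?root_prod_XsubC //.
    by rewrite lead_coef_eq0 map_poly_eq0 monic_neq0.
  case: z {zin} rz => a b rz /=; have [-> //|nzb] := eqVneq b 0.
  pose quad : {poly R} := ('X - a%:P) ^+ 2 + (b ^+ 2)%:P.
  have quadz : (map_poly (real_complex R) quad).[(a +i* b)%C] = 0.
    rewrite rmorphD rmorphXn rmorphB /= map_polyX !map_polyC /= !hornerE.
    by apply/eqP; rewrite eq_complex /=; apply/andP; split; apply/eqP; ring.
  have sq : size quad = 3%N.
    rewrite size_polyDl; rewrite size_exp_XsubC //.
    by rewrite (leq_ltn_trans (size_polyC_leq1 _)).
  (* The remainder of [p] modulo [quad] is linear with real coefficients and vanishes at a + ib with
     b nonzero: the imaginary part gives [r1 = 0], then the real part gives [r0 = 0]. *)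
  have := rz; rewrite /root /pc (divp_eq p quad) rmorphD rmorphM /= !hornerE quadz.
  rewrite mulr0 add0r.
  have sr : (size (p %% quad)%R <= 2)%N.
    by rewrite -ltnS -sq ltn_modp -size_poly_eq0 sq.
  have [r1 [r0 er]] : exists r1 r0, p %% quad = r1 *: 'X + r0%:P.
    exists (p %% quad)`_1, (p %% quad)`_0; apply/polyP => i.
    rewrite coefD coefZ coefX coefC.
    case: i => [|[|i]] /=; rewrite ?mulr0 ?mulr1 ?addr0 ?add0r //.
    by rewrite nth_default // (leq_trans sr).
  rewrite er rmorphD /= map_polyZ /= map_polyX map_polyC /= !hornerE.
  rewrite eq_complex /= => /andP[e0 e1].
  have r10 : r1 = 0.
    move: e1; rewrite mul0r !addr0 mulf_eq0 (negPf nzb) orbF => /eqP //.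
  move: e0; rewrite r10 !mul0r subr0 add0r => /eqP r00.
  case: (@orth_poly_no_quad k p a b (p %/ quad) pos op).
  by rewrite {1}(divp_eq p quad) er r10 r00 scale0r !addr0 mulrC.
pose rs := map (@complex.Re R) zs.
have defp : p = \prod_(x <- rs) ('X - x%:P).
  apply: (map_poly_inj (real_complex R)); rewrite -/pc defpc.
  rewrite lead_coef_map (monicP pm) rmorph1 scale1r rmorph_prod big_map.
  apply: eq_big_seq => z /zreal {1}->.
  by rewrite rmorphB /= map_polyX map_polyC.
exists rs => //; apply/negPn/negP => nu.
(* A list with a repetition can be reordered to begin with a repeated entry [a]; then
   [('X - a%:P) ^+ 2] divides [p]. *)
have [a [s prs]] :
    exists a s, perm_eq rs [:: a, a & s].
  elim: rs {defp} nu => //= x s IH; rewrite negb_and negbK => /orP[xs|/IH].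
    exists x, (rem x s); rewrite perm_cons; exact: perm_to_rem.
  case=> a [s' p']; exists a, (x :: s').
  rewrite -(perm_cons x) in p'; apply: perm_trans p' _.
  by rewrite -[X in perm_eq X](cat1s x) (perm_catCA [:: x] [:: a; a] s').
apply: (@orth_poly_no_quad k p a 0 (\prod_(x <- s) ('X - x%:P)) pos op).
rewrite defp (perm_big _ prs) !big_cons expr0n /=; ring.
Qed.

Lemma orth_poly_accept k p : form_pos k -> orth_poly k p ->
  horner_mx A p = 0 -> diagonalizable A.
Proof.
move=> pos op pA; have [rs urs defp] := orth_poly_split pos op.
by apply/diagonalizableP; exists rs => //; rewrite -defp; apply: mxminpoly_min.
Qed.

(** In an eigenbasis <p, p> is the sum of the squares of the values of [p] at the eigenvalues, all
    zero only if p(A) = 0. This justifies the rejections of the real test. *)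
Lemma diagonalizable_form_gt0 p : diagonalizable A -> horner_mx A p != 0 ->
  0 < trace_form p p.
Proof.
case=> P Pu /(similar_diagLR Pu)[D]; rewrite conjVmx // => defA.
have Vu : invmx P \in unitmx by rewrite unitmx_inv.
have hA g : horner_mx A g = invmx P *m diag_mx (map_mx (horner g) D) *m P.
  have -> : A = invmx P *m diag_mx D *m invmx (invmx P) by rewrite invmxK.
  by rewrite horner_mx_uconj // horner_mx_diag invmxK.
rewrite /trace_form !hA mxtrace_mulC mulmxA mulmxV // mul1mx mxtrace_diag => nz.
rewrite lt_neqAle sumr_ge0 ?andbT; last first.
  by move=> i _; rewrite mxE hornerM -expr2 sqr_ge0.
apply: contra nz; rewrite eq_sym psumr_eq0; last first.
  by move=> i _; rewrite mxE hornerM -expr2 sqr_ge0.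
move=> /allP z; rewrite (_ : map_mx _ _ = 0) ?linear0 ?mulmx0 ?mul0mx //.
apply/rowP => i; rewrite !mxE; apply/eqP.
by have := z i (mem_index_enum i); rewrite mxE hornerM mulf_eq0 orbb.
Qed.

(** The characteristic polynomial, of size [n.+2], is isotropic by Cayley-Hamilton. This bounds the
    number of rounds of the real test. *)
Lemma form_pos_bound : ~ form_pos n.+2.
Proof.
move=> /(_ (char_poly A)); rewrite monic_neq0 ?char_poly_monic // size_char_poly.
by rewrite leqnn /trace_form rmorphM /= Cayley_Hamilton mulr0 linear0 ltxx => /(_ isT isT).
Qed.

End RealDiag.

(** * Programs in continuation-passing style *)

Section Monad.
Variables (K : numFieldType) (I : Type) (q : nat) (O : Type).
Notation opd := (operand K I).

(* A computation receives the current memory size, so that it can name the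
   registers it creates. *)
Definition cprog (T : Type) :=
  nat -> (nat -> T -> prog K I q O) -> prog K I q O.

Definition ret T (a : T) : cprog T := fun d k => k d a.

Definition bind T U (c : cprog T) (f : T -> cprog U) : cprog U :=
  fun d k => c d (fun d' a => f a d' k).

Definition arithC op a b : cprog opd :=
  fun d k => Arith op a b (k d.+1 (Reg d)).

Definition queryC v : cprog opd := fun d k => Query v (k d.+1 (Reg d)).

Definition zeroC a : cprog bool := fun d k => IfZero a (k d true) (k d false).

Definition nonnegC a : cprog bool :=
  fun d k => IfNonneg a (k d true) (k d false).

Notation "x <- c ; f" := (bind c (fun x => f))
  (at level 100, c at next level, f at level 200, right associativity).

Section Loops.
Variable J : finType.

Fixpoint tab_seq (s : seq J) (c : J -> cprog opd) (acc : J -> opd) :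
    cprog (J -> opd) :=
  if s is j :: s' then
    a <- c j; tab_seq s' c (fun x => if x == j then a else acc x)
  else ret acc.

Definition tabC (c : J -> cprog opd) : cprog (J -> opd) :=
  tab_seq (enum J) c (fun=> Const 0).

Fixpoint sum_acc (s : seq J) (c : J -> cprog opd) (acc : opd) : cprog opd :=
  if s is j :: s' then
    a <- c j; b <- arithC Add acc a; sum_acc s' c b
  else ret acc.

Definition sumC (c : J -> cprog opd) : cprog opd :=
  sum_acc (enum J) c (Const 0).

Fixpoint find_seq (s : seq J) (u : J -> opd) : cprog (option J) :=
  if s is j :: s' then
    b <- zeroC (u j); if b then find_seq s' u else ret (Some j)
  else ret None.

End Loops.

Section Spec.
Variable m : machine K I q.

Definition ok (p : prog K I q O) (mem tape : seq K) (t c : nat)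
    (Q : seq K -> O -> Prop) : Prop :=
  exists r, [/\ run m p mem tape = Some r, Q (memory r) (leaf r),
                (ops r <= t)%N & (calls r <= c)%N].

(** Memory only grows and is never overwritten; quantifying over its extensions makes the meaning of
    an operand stable under all later steps. *)
Definition den (mem : seq K) (a : opd) (x : K) : Prop :=
  forall mem', prefix mem mem' -> value (input m) mem' a = x.

(** A Hoare triple with costs for programs in continuation-passing style: any continuation that is
    correct from [post] within a budget yields a whole that is correct within the sum of the
    budgets. The tape reaches the continuation intact, so such computations draw no samples. *)
Definition spec (mem : seq K) T (c : cprog T) (t cl : nat)
    (post : seq K -> T -> Prop) : Prop :=
  forall tape k t0 c0 Q,
  (forall mem' a, prefix mem mem' -> post mem' a ->
     ok (k (size mem') a) mem' tape t0 c0 Q) ->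
  ok (c (size mem) k) mem tape (t + t0) (cl + c0) Q.

Lemma ok_le p mem tape t t' c c' Q : ok p mem tape t c Q ->
  (t <= t')%N -> (c <= c')%N -> ok p mem tape t' c' Q.
Proof.
by case=> r [? ? ? ?] ? ?; exists r; split=> //; apply: leq_trans; eassumption.
Qed.

Lemma ok_charge o c p p' mem mem' tape tape' t cl Q :
  run m p mem tape = omap (charge o c) (run m p' mem' tape') ->
  ok p' mem' tape' t cl Q -> ok p mem tape (o + t) (c + cl) Q.
Proof.
move=> e [r [er ? ? ?]]; exists (charge o c r).
by rewrite e er; split=> //=; rewrite leq_add2l.
Qed.

Lemma spec_le mem T (c : cprog T) t t' cl cl' post :
  spec mem c t cl post -> (t <= t')%N -> (cl <= cl')%N ->
  spec mem c t' cl' post.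
Proof.
move=> H tt' cc' tape k t0 c0 Q /H ?.
by apply: ok_le; [eassumption | rewrite leq_add2r | rewrite leq_add2r].
Qed.

Lemma spec_post mem T (c : cprog T) t cl (post post' : seq K -> T -> Prop) :
  spec mem c t cl post ->
  (forall mem' a, prefix mem mem' -> post mem' a -> post' mem' a) ->
  spec mem c t cl post'.
Proof.
by move=> H pp' tape k t0 c0 Q h; apply: H => mem' a pm /(pp' _ _ pm); apply: h.
Qed.

Lemma spec_ret mem T (a : T) (post : seq K -> T -> Prop) :
  post mem a -> spec mem (ret a) 0 0 post.
Proof. by move=> pa tape k t0 c0 Q; apply => //; apply: prefix_refl. Qed.

Lemma spec_bind mem T U (c : cprog T) (f : T -> cprog U) t1 t2 c1 c2 post1 post :
  spec mem c t1 c1 post1 ->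
  (forall mem' a, prefix mem mem' -> post1 mem' a ->
     spec mem' (f a) t2 c2 post) ->
  spec mem (bind c f) (t1 + t2) (c1 + c2) post.
Proof.
move=> Hc Hf tape k t0 c0 Q Hk; rewrite -!addnA; apply: Hc => mem' a pm pa.
apply: (Hf _ _ pm pa) => mem'' b pm' pb.
by apply: Hk => //; apply: prefix_trans pm'.
Qed.

Lemma spec_ok mem tape (c : cprog O) t cl post : spec mem c t cl post ->
  ok (c (size mem) (fun _ o => Return _ _ _ o)) mem tape t cl post.
Proof.
move=> H; rewrite -[t]addn0 -[cl]addn0; apply: H => mem' o _ po.
by exists (Result o mem' 0 0).
Qed.

Lemma den_prefix mem mem' a x : prefix mem mem' -> den mem a x -> den mem' a x.
Proof. by move=> p d mem'' p'; apply/d/(prefix_trans p). Qed.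

Lemma den_const mem c : den mem (Const c) c. Proof. by []. Qed.

Lemma den_input mem i : den mem (Input i) (input m i). Proof. by []. Qed.

Lemma den_val mem a x : den mem a x -> value (input m) mem a = x.
Proof. by apply; apply: prefix_refl. Qed.

Lemma den_reg mem1 mem2 i : (i < size mem2)%N ->
  den (mem1 ++ mem2) (Reg (size mem1 + i)) (nth 0 mem2 i).
Proof.
move=> lti mem' /prefixP[s ->] /=; rewrite -catA nth_cat ltnNge leq_addr /=.
by rewrite addKn nth_cat lti.
Qed.

Lemma den_last mem x : den (rcons mem x) (Reg (size mem)) x.
Proof. by rewrite -cats1 -[size mem]addn0; apply: (@den_reg mem [:: x] 0). Qed.

Lemma spec_arith mem op a b x y z : den mem a x -> den mem b y ->
  arith op x y = Some z ->
  spec mem (arithC op a b) 1 0 (fun mem' r => den mem' r z).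
Proof.
move=> da db e tape k t0 c0 Q Hk.
have px : prefix mem (rcons mem z) by apply: prefix_rcons.
have := Hk _ (Reg (size mem)) px (@den_last _ _); rewrite size_rcons.
apply: ok_charge.
by rewrite /= (den_val da) (den_val db) e.
Qed.

Lemma spec_query mem (v : 'rV[opd]_q) (x : 'rV[K]_q) g : oracle m = Some g ->
  (forall i, den mem (v 0 i) (x 0 i)) ->
  spec mem (queryC v) 0 1 (fun mem' r => den mem' r (g x)).
Proof.
move=> eg dv tape k t0 c0 Q Hk.
have px : prefix mem (rcons mem (g x)) by apply: prefix_rcons.
have := Hk _ (Reg (size mem)) px (@den_last _ _); rewrite size_rcons.
apply: ok_charge; rewrite /= eg.
suff -> : map_mx (value (input m) mem) v = x by [].
by apply/rowP => i; rewrite mxE; apply: den_val.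
Qed.

Lemma spec_zero mem a x : den mem a x ->
  spec mem (zeroC a) 1 0 (fun _ b => b = (x == 0)).
Proof.
move=> da tape k t0 c0 Q Hk.
have := Hk _ (x == 0) (prefix_refl _) erefl; apply: ok_charge.
by rewrite /= (den_val da); case: (x == 0).
Qed.

Lemma spec_nonneg mem a x : ordered m -> den mem a x ->
  spec mem (nonnegC a) 1 0 (fun _ b => b = (0 <= x)).
Proof.
move=> om da tape k t0 c0 Q Hk.
have := Hk _ (0 <= x) (prefix_refl _) erefl; apply: ok_charge.
by rewrite /= om (den_val da); case: (0 <= x).
Qed.

Section LoopSpec.
Variable J : finType.

Lemma spec_tab mem (c : J -> cprog opd) (x : J -> K) t cl :
  (forall mem' j, prefix mem mem' ->
     spec mem' (c j) t cl (fun mem'' a => den mem'' a (x j))) ->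
  spec mem (tabC c) (#|J| * t) (#|J| * cl)
    (fun mem' f => forall j, den mem' (f j) (x j)).
Proof.
rewrite cardE /tabC.
(* Loop invariant: the entries outside the list still to be visited are already correct. At the
   start every index is still to be visited. *)
pose D mem (f : J -> opd) (s : seq J) := forall j, j \notin s -> den mem (f j) (x j).
have: D mem (fun=> Const 0) (enum J) by move=> j; rewrite mem_enum.
elim: (enum J) mem (fun=> _) => [|j s IH] mem acc Dacc Hc /=.
  by apply: spec_ret => j; apply: Dacc.
rewrite !mulSn; apply: spec_bind; first exact/Hc/prefix_refl.
move=> mem1 a p1 da; apply: IH => [i ins|mem' i p']; last first.
  by apply: Hc; apply: prefix_trans p'.
case: eqVneq => [-> //|ij]; apply: den_prefix p1 _.
by apply: Dacc; rewrite inE negb_or ij.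
Qed.

Lemma spec_sum mem (c : J -> cprog opd) (x : J -> K) t cl :
  (forall mem' j, prefix mem mem' ->
     spec mem' (c j) t cl (fun mem'' a => den mem'' a (x j))) ->
  spec mem (sumC c) (#|J| * t.+1) (#|J| * cl)
    (fun mem' a => den mem' a (\sum_j x j)).
Proof.
move=> Hc; rewrite cardE -big_enum /=.
suff H acc y : den mem acc y -> spec mem (sum_acc (enum J) c acc)
    (size (enum J) * t.+1) (size (enum J) * cl)
    (fun mem' a => den mem' a (y + \sum_(j <- enum J) x j)).
  by apply: spec_post (H _ 0 _) _ => // mem' a _; rewrite add0r.
elim: (enum J) mem acc y Hc => [|j s IH] mem acc y Hc dacc /=.
  by rewrite big_nil addr0; apply: spec_ret.
rewrite big_cons addrA !mulSn addSnnS -add1n; apply: spec_bind.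
  exact/Hc/prefix_refl.
move=> mem1 a p1 da; rewrite -[(_ * cl)%N]add0n; apply: spec_bind.
  exact: spec_arith (den_prefix p1 dacc) da _.
move=> mem2 b p2 db; apply: IH => // mem' i p'.
by apply: Hc; apply: prefix_trans p'; apply: prefix_trans p2.
Qed.

Lemma spec_find mem (s : seq J) (u : J -> opd) (x : J -> K) :
  (forall j, den mem (u j) (x j)) ->
  spec mem (find_seq s u) (size s) 0
    (fun _ o => if o is Some j then j \in s /\ x j != 0
                else forall j, j \in s -> x j = 0).
Proof.
elim: s mem => [|j s IH] mem du /=; first exact: spec_ret.
rewrite -add1n -[0%N]/(0 + 0)%N; apply: spec_bind; first exact: spec_zero (du j).
move=> mem1 b p1 ->; have [xj0|xj] := eqVneq (x j) 0; last first.
  apply: spec_le; first apply: spec_ret; first by rewrite mem_head.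
    by [].
  by [].
apply: spec_post; first by apply: IH => i; apply: den_prefix p1 _.
move=> mem' [i|] _ /=; first by case=> si xi; rewrite inE si orbT.
by move=> H i; rewrite inE => /predU1P[->|/H].
Qed.

End LoopSpec.
End Spec.
End Monad.

Notation "x <- c ; f" := (bind c (fun x => f))
  (at level 100, c at next level, f at level 200, right associativity).

(** * Running one program as a subroutine of another *)

Section Embed.
Variables (K : numFieldType) (I : Type) (q : nat) (O : Type) (I' O' : Type).
Notation opd := (operand K I).
Notation opd' := (operand K I').
Variable sg : I' -> opd.

(* Registers of the embedded program are shifted by [base]; those it has not
   created yet read as 0. *)
Definition embed_opd (base cnt : nat) (a : opd') : opd :=
  match a with
  | Const c => Const c
  | Input i => sg i
  | Reg i => if (i < cnt)%N then Reg (base + i) else Const 0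
  end.

(** Passing over [Sample] and [Query] is harmless: a successful run on an empty tape and without
    oracle never meets them. *)
Fixpoint embed (p : prog K I' 0 O') (base cnt : nat)
    (k : nat -> (opd' -> opd) * O' -> prog K I q O) : prog K I q O :=
  match p with
  | Return o => k (base + cnt)%N (embed_opd base cnt, o)
  | Arith op a b p' => Arith op (embed_opd base cnt a) (embed_opd base cnt b)
                         (embed p' base cnt.+1 k)
  | Sample p' | Query _ p' => embed p' base cnt k
  | IfZero a p1 p2 =>
      IfZero (embed_opd base cnt a) (embed p1 base cnt k) (embed p2 base cnt k)
  | IfNonneg a p1 p2 =>
      IfNonneg (embed_opd base cnt a)
        (embed p1 base cnt k) (embed p2 base cnt k)
  end.

Definition embedC (p : prog K I' 0 O') : cprog K I q O ((opd' -> opd) * O') :=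
  fun d k => embed p d 0 k.

Variables (m : machine K I q) (inp : I' -> K).

Lemma den_embed mem0 mem a : (forall i, den m mem0 (sg i) (inp i)) ->
  den m (mem0 ++ mem) (embed_opd (size mem0) (size mem) a) (value inp mem a).
Proof.
move=> dsg; case: a => [c|i|i] /=; first exact: den_const.
  by apply: den_prefix (dsg i); apply: prefix_prefix.
by case: ltnP => [lti|lei]; [apply: den_reg | rewrite nth_default].
Qed.

Lemma spec_embed mem0 p r :
  run (Machine inp None (ordered m)) p [::] [::] = Some r ->
  (forall i, den m mem0 (sg i) (inp i)) ->
  spec m mem0 (embedC p) (ops r) 0 (fun mem' to => to.2 = leaf r /\
    forall a, den m mem' (to.1 a) (value inp (memory r) a)).
Proof.
move=> er dsg tape k t0 c0 Q Hk; rewrite add0n /embedC.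
(* Generalised to an arbitrary memory [mem] of the subroutine, which lies right after [mem0] in the
   memory of the caller. *)
suff H mem : run (Machine inp None (ordered m)) p mem [::] = Some r ->
    ok m (embed p (size mem0) (size mem) k) (mem0 ++ mem) tape (ops r + t0) c0 Q.
  by have := H [::] er; rewrite cats0.
elim: p mem r Hk {er} => [o|op a b p IH|p IH|v p IH|a p1 IH1 p2 IH2|a p1 IH1 p2 IH2]
  mem r Hk //=.
- case=> er; rewrite -{r}er /= add0n in Hk *; rewrite -size_cat; apply: Hk.
    exact: prefix_prefix.
  by split=> // a; apply: den_embed.
- case ez: (arith _ _ _) => [z|//].
  case er: (run _ p _ _) => [r'|//] [er']; rewrite -{r}er' /= in Hk *.
  rewrite -addnA -[c0]add0n.
  apply: ok_charge _ (IH _ _ Hk er).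
  rewrite size_rcons /= !(den_val (@den_embed mem0 mem _ dsg)) ez.
  by rewrite rcons_cat.
- case er: (if _ then _ else _) => [r'|//] [er']; rewrite -{r}er' /= in Hk *.
  rewrite -addnA -[c0]add0n; case: ifP er => z er;
    [apply: ok_charge _ (IH1 _ _ Hk er) | apply: ok_charge _ (IH2 _ _ Hk er)] => //;
    by rewrite /= (den_val (@den_embed mem0 mem _ dsg)) z.
- case om: (ordered m) => //.
  case er: (if _ then _ else _) => [r'|//] [er']; rewrite -{r}er' /= in Hk *.
  rewrite -addnA -[c0]add0n; case: ifP er => z er;
    [apply: ok_charge _ (IH1 _ _ Hk _) | apply: ok_charge _ (IH2 _ _ Hk _)];
    rewrite ?om; try eassumption;
    by rewrite /= om (den_val (@den_embed mem0 mem _ dsg)) z.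
Qed.

End Embed.

(** * Matrix programs *)

Definition computes_matmul (K : numFieldType) (ord : bool) (N : nat)
    (P : prog K (matmul_input N) 0 'M[operand K (matmul_input N)]_N)
    (M : nat) : Prop :=
  forall A B : 'M[K]_N, let m := matmul_machine ord A B in
  exists r, [/\ run m P [::] [::] = Some r,
    map_mx (value (input m) (memory r)) (leaf r) = A *m B & (ops r <= M)%N].

Section MatrixPrograms.
Variables (K : numFieldType) (I : Type) (q : nat) (O : Type) (n : nat).
Notation N := n.+1.
Notation opd := (operand K I).
Notation cprog := (cprog K I q O).
Variable mulprog : prog K (matmul_input N) 0 'M[operand K (matmul_input N)]_N.

Definition const_opd (X : 'M[K]_N) : 'M[opd]_N := map_mx Const X.

Definition tab_mxC (c : 'I_N -> 'I_N -> cprog opd) : cprog 'M[opd]_N :=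
  f <- tabC (fun ij : 'I_N * 'I_N => c ij.1 ij.2);
  ret (\matrix_(i, j) f (i, j)).

Definition mulmxC (X Y : 'M[opd]_N) : cprog 'M[opd]_N :=
  to <- embedC (fun i => match i with
                         | inl ij => X ij.1 ij.2
                         | inr ij => Y ij.1 ij.2
                         end) mulprog;
  ret (map_mx to.1 to.2).

Definition submxC (X Y : 'M[opd]_N) : cprog 'M[opd]_N :=
  tab_mxC (fun i j => arithC Defs.Sub (X i j) (Y i j)).

Definition zero_mxC (X : 'M[opd]_N) : cprog bool :=
  o <- find_seq (enum {: 'I_N * 'I_N}) (fun ij => X ij.1 ij.2); ret (o == None).

Definition traceC (X : 'M[opd]_N) : cprog opd :=
  sumC (fun i => ret (X i i)).

(** Summing over pairs of indices gives the trace of a product in O(N^2) operations, without forming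
    the product. *)
Definition trace_mulC (X Y : 'M[opd]_N) : cprog opd :=
  sumC (fun ij : 'I_N * 'I_N => arithC Mul (X ij.1 ij.2) (Y ij.2 ij.1)).

Variables (m : machine K I q) (M : nat).
Hypothesis mulP : computes_matmul (ordered m) mulprog M.

Definition den_mx mem (X : 'M[opd]_N) (V : 'M[K]_N) :=
  forall i j, den m mem (X i j) (V i j).

Lemma den_mx_prefix mem mem' X V : prefix mem mem' -> den_mx mem X V ->
  den_mx mem' X V.
Proof. by move=> p d i j; apply: den_prefix p _. Qed.

Lemma den_mx_const mem X : den_mx mem (const_opd X) X.
Proof. by move=> i j; rewrite mxE; apply: den_const. Qed.

Lemma den_mx_map mem mem' X V : prefix mem mem' -> den_mx mem X V ->
  map_mx (value (input m) mem') X = V.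
Proof. by move=> p d; apply/matrixP => i j; rewrite mxE; apply: d. Qed.

Lemma spec_tab_mx mem c (V : 'M[K]_N) t cl :
  (forall mem' i j, prefix mem mem' ->
     spec m mem' (c i j) t cl (fun mem'' a => den m mem'' a (V i j))) ->
  spec m mem (tab_mxC c) (N * N * t) (N * N * cl)
    (fun mem' X => den_mx mem' X V).
Proof.
move=> Hc; apply: spec_le.
- apply: spec_bind; first by apply: spec_tab => mem' ij p; apply: Hc.
  by move=> mem' f _ df; apply: spec_ret => i j; rewrite mxE; apply: df.
- by rewrite card_prod card_ord addn0.
- by rewrite card_prod card_ord addn0.
Qed.

Lemma spec_mulmx mem X Y U V : den_mx mem X U -> den_mx mem Y V ->
  spec m mem (mulmxC X Y) M 0 (fun mem' Z => den_mx mem' Z (U *m V)).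
Proof.
move=> dX dY; have [r [er lr tr]] := mulP U V.
apply: spec_le; [apply: spec_bind| |].
- by apply: spec_embed er _ => -[[i j]|[i j]]; [apply: dX | apply: dY].
- move=> mem' [f l] _ /= [-> df]; apply: spec_ret => i j.
  rewrite -lr !mxE; exact: df.
- by rewrite addn0.
- by [].
Qed.

Lemma spec_submx mem X Y U V : den_mx mem X U -> den_mx mem Y V ->
  spec m mem (submxC X Y) (N * N) 0 (fun mem' Z => den_mx mem' Z (U - V)).
Proof.
move=> dX dY; apply: spec_le; first apply: (@spec_tab_mx _ _ _ 1 0).
- move=> mem' i j p; rewrite !mxE; apply: spec_arith; last by [].
    exact: den_prefix p (dX i j).
  exact: den_prefix p (dY i j).
- by rewrite muln1.
- by rewrite muln0.
Qed.

Lemma spec_zero_mx mem X U : den_mx mem X U ->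
  spec m mem (zero_mxC X) (N * N) 0 (fun _ b => b = (U == 0)).
Proof.
move=> dX; apply: spec_le; [apply: spec_bind| |].
- by apply: (@spec_find _ _ _ _ m _ mem _ _ (fun ij => U ij.1 ij.2)) => ij; apply: dX.
- move=> mem' o _ Ho; apply: spec_ret; case: o Ho => [[i j] [_]|H] /=.
    by move=> /negP H; apply/esym/negP => /eqP U0; apply: H; rewrite U0 mxE.
  apply/esym/eqP/matrixP => i j.
  by rewrite mxE (H (i, j)) // mem_enum.
- by rewrite addn0 -cardE card_prod card_ord.
- by [].
Qed.

Lemma spec_trace mem X U : den_mx mem X U ->
  spec m mem (traceC X) N 0 (fun mem' a => den m mem' a (\tr U)).
Proof.
move=> dX; apply: spec_le; first apply: (@spec_sum _ _ _ _ _ _ _ _ _ 0 0).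
- by move=> mem' i p; apply: spec_ret; apply: den_prefix p (dX i i).
- by rewrite card_ord muln1.
- by rewrite muln0.
Qed.

Lemma spec_trace_mul mem X Y U V : den_mx mem X U -> den_mx mem Y V ->
  spec m mem (trace_mulC X Y) (N * N * 2) 0
    (fun mem' a => den m mem' a (\tr (U *m V))).
Proof.
move=> dX dY; have -> : \tr (U *m V) = \sum_(ij : 'I_N * 'I_N) U ij.1 ij.2 * V ij.2 ij.1.
  rewrite -(pair_bigA _ (fun i j => U i j * V j i)) /=.
  by apply: eq_bigr => i _; rewrite mxE.
apply: spec_le; first apply: (@spec_sum _ _ _ _ _ _ _ _ _ 1 0).
- move=> mem' ij p; apply: spec_arith; last by [].
    exact: den_prefix p (dX _ _).
  exact: den_prefix p (dY _ _).
- by rewrite card_prod card_ord.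
- by rewrite muln0.
Qed.

End MatrixPrograms.

(** * Elimination *)

Section Elimination.
Variables (K : numFieldType) (n : nat) (V : 'M[K]_n.+1).
Notation N := n.+1.

Definition cols_before (k : nat) (c : 'I_N -> K) : 'cV[K]_N :=
  \sum_(t < N | (t < k)%N) c t *: col t V.

(** Gauss-Jordan elimination without row exchanges: [W] accumulates the row operations, and [s t] is
    the pivot row of column [t]. *)
Definition elim_inv (k : nat) (s : 'I_N -> 'I_N) (W : 'M[K]_N) : Prop :=
  [/\ W \in unitmx,
      forall t : 'I_N, (t < k)%N -> W *m col t V = delta_mx (s t) 0 &
      forall t t' : 'I_N, (t < k)%N -> (t' < k)%N -> s t = s t' -> t = t'].

(** A rank-one update of [W]: row [i] is divided by the pivot [u i 0], then multiples of it are
    subtracted from the other rows so that the column [u] becomes the unit vector at [i]. *)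
Definition pivot_step (i : 'I_N) (u : 'cV[K]_N) (W : 'M[K]_N) : 'M[K]_N :=
  W - (u - delta_mx i 0) *m ((u i 0)^-1 *: row i W).

Lemma elim_inv_step k s W (i : 'I_N) : (k < N)%N ->
  elim_inv k s W -> (W *m col (inord k) V) i 0 != 0 ->
  (forall t : 'I_N, (t < k)%N -> s t != i) ->
  elim_inv k.+1 (fun t => if t == inord k then i else s t)
    (pivot_step i (W *m col (inord k) V) W).
Proof.
move=> ltk [Wu Ws sinj]; move Du: (W *m _) => u ui si.
have step v : pivot_step i u W *m v =
    W *m v - ((u i 0)^-1 * (W *m v) i 0) *: (u - delta_mx i 0).
  rewrite mulmxBl -mulmxA -scalemxAl -row_mul; congr (_ - _).
  by rewrite [row i _]mx11_scalar mxE -scalemxAr mul_mx_scalar scalerA.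
have eqk (t : 'I_N) : (t == inord k) = (t == k :> nat).
  by rewrite -val_eqE /= inordK.
split.
(* The left factor undoes the pivot step: the product is [W], which is invertible. *)
- suff: (1%:M + (u - delta_mx i 0) *m delta_mx 0 i) *m pivot_step i u W \in unitmx.
    by rewrite unitmx_mul => /andP[].
  rewrite mulmxDl mul1mx -mulmxA -rowE /pivot_step raddfB /= row_mul.
  rewrite (_ : row i (u - _) = (u i 0 - 1)%:M); last first.
    by rewrite [LHS]mx11_scalar !mxE !eqxx.
  rewrite mul_scalar_mx scalerA mulrBl mul1r mulfV // scalerBl scale1r subKr.
  by rewrite subrK.
- move=> t; rewrite ltnS eqk step leq_eqVlt.
  have [tk _|tk /= ltt] := eqVneq (t : nat) k.
    have -> : t = inord k by apply/val_inj; rewrite /= inordK.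
    by rewrite Du mulVf // scale1r subKr.
  by rewrite Ws // mxE eq_sym (negPf (si _ ltt)) mulr0 scale0r subr0.
- move=> t t'; rewrite !ltnS !eqk (leq_eqVlt t) (leq_eqVlt t').
  have [tk _|tk /= ltt] := eqVneq (t : nat) k; have [t'k _|t'k /= ltt'] := eqVneq (t' : nat) k.
  + by move=> _; apply/val_inj; rewrite /= tk.
  + by move=> e; have := si _ ltt'; rewrite e eqxx.
  + by move=> e; have := si _ ltt; rewrite e eqxx.
  + exact: sinj.
Qed.

(** After all [N] steps, [W *m V] has distinct unit vectors as columns; listing the rows of [W] in
    the order [s] turns it into the identity. *)
Lemma elim_inv_inverse s W : elim_inv N s W ->
  (\matrix_(i, j) W (s i) j) *m V = 1%:M.
Proof.
move=> [_ Ws sinj]; apply/matrixP => i j.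
transitivity ((W *m col j V) (s i) 0).
  by rewrite !mxE; apply: eq_bigr => l _; rewrite !mxE.
rewrite Ws // !mxE andbT; congr (_%:R); congr nat_of_bool.
by apply/eqP/eqP => [/sinj ->|->].
Qed.

(** Applying [W] turns a relation among the treated columns into one among distinct unit vectors. *)
Lemma elim_inv_indep k s W c : elim_inv k s W -> cols_before k c = 0 ->
  forall t : 'I_N, (t < k)%N -> c t = 0.
Proof.
move=> [_ Ws sinj] c0 t ltt.
have /matrixP/(_ (s t) 0) : W *m cols_before k c = 0 by rewrite c0 mulmx0.
rewrite mulmx_sumr summxE (bigD1 t) //= -scalemxAr Ws // !mxE !eqxx mulr1.
rewrite big1 ?addr0 // => t' /andP[ltt' nt].
rewrite -scalemxAr Ws // !mxE andbT; case: eqP => [/sinj e|]; last by rewrite mulr0.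
by rewrite e ?eqxx // in nt.
Qed.

(** Without a pivot in a free row, the current column is supported, after applying [W], on the pivot
    rows; its entries there are the coefficients of the dependence. *)
Lemma elim_inv_dep k s W : elim_inv k s W ->
  (forall i, (forall t : 'I_N, (t < k)%N -> s t != i) ->
     (W *m col (inord k) V) i 0 = 0) ->
  col (inord k) V = cols_before k (fun t => (W *m col (inord k) V) (s t) 0).
Proof.
move=> [Wu Ws sinj]; move Du: (W *m _) => u u0.
apply: (can_inj (mulKmx Wu)); rewrite Du mulmx_sumr; apply/colP => i.
rewrite summxE.
have [/existsP[t /andP[ltt /eqP <-]]|none] :=
    boolP [exists t : 'I_N, (t < k)%N && (s t == i)].
  rewrite (bigD1 t) //= -scalemxAr Ws // !mxE !eqxx mulr1 big1 ?addr0 //.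
  move=> t' /andP[ltt' nt]; rewrite -scalemxAr Ws // !mxE andbT.
  case: eqP => [/sinj e|]; last by rewrite mulr0.
  by rewrite e ?eqxx // in nt.
have ni (t : 'I_N) : (t < k)%N -> s t != i.
  by move=> ltt; apply: contra none => st; apply/existsP; exists t; rewrite ltt.
rewrite u0 // big1 // => t ltt.
by rewrite -scalemxAr Ws // !mxE eq_sym (negPf (ni _ ltt)) mulr0.
Qed.

Lemma cols_dep_singular k c : (k < N)%N -> col (inord k) V = cols_before k c ->
  V \notin unitmx.
Proof.
move=> ltk dep; apply/negP => Vu.
pose v : 'cV[K]_N := delta_mx (inord k) 0 - \sum_(t < N | (t < k)%N) c t *: delta_mx t 0.
have Vv : V *m v = 0.
  rewrite mulmxBr -colE dep mulmx_sumr; apply/eqP; rewrite subr_eq0; apply/eqP.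
  by apply: eq_bigr => t _; rewrite -scalemxAr -colE.
have /colP/(_ (inord k)) : v = 0 by rewrite -(mulKmx Vu v) Vv mulmx0.
rewrite !mxE summxE big1 => [|t ltt].
  by rewrite !eqxx subr0 => /eqP; rewrite oner_eq0.
by rewrite !mxE -val_eqE /= inordK // gtn_eqF ?mulr0.
Qed.

End Elimination.

Section EliminationProgram.
Variables (K : numFieldType) (I : Type) (q : nat) (O : Type) (n : nat).
Notation N := n.+1.
Notation opd := (operand K I).
Notation cprog := (cprog K I q O).

(** [Dependent] carries the first dependent column and its coefficients. For [T1] it only signals
    singularity; for the Hankel matrix the coefficients define the radical of the characteristic
    polynomial. *)
Variant elim_result :=
  | Dependent of nat & ('I_N -> opd)
  | Inverse of 'M[opd]_N.

Definition free_rows (k : nat) (s : 'I_N -> 'I_N) : seq 'I_N :=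
  [seq i <- enum 'I_N | [forall t : 'I_N, (t < k)%N ==> (s t != i)]].

Definition pivot_stepC (i : 'I_N) (u : 'I_N -> opd) (W : 'M[opd]_N) :
    cprog 'M[opd]_N :=
  w <- tabC (fun l => arithC Div (W i l) (u i));
  tab_mxC (fun a l => if a == i then ret (w l)
                      else x <- arithC Mul (u a) (w l);
                           arithC Defs.Sub (W a l) x).

(** Only [W] is updated. The current column is recomputed as [W] times a column of [X], which costs
    O(N^2), like the pivot step. *)
Fixpoint elimC (X : 'M[opd]_N) (fuel k : nat) (s : 'I_N -> 'I_N)
    (W : 'M[opd]_N) : cprog elim_result :=
  if fuel is fuel'.+1 then
    u <- tabC (fun i => sumC (fun l => arithC Mul (W i l) (X l (inord k))));
    o <- find_seq (free_rows k s) u;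
    if o is Some i then
      W' <- pivot_stepC i u W;
      elimC X fuel' k.+1 (fun t => if t == inord k then i else s t) W'
    else ret (Dependent k (fun t => u (s t)))
  else ret (Inverse (\matrix_(i, j) W (s i) j)).

Definition eliminateC (X : 'M[opd]_N) : cprog elim_result :=
  elimC X N 0 id (const_opd I 1%:M).

Variable m : machine K I q.
Notation den_mx := (den_mx m).

Definition elim_post (V : 'M[K]_N) mem (e : elim_result) : Prop :=
  match e with
  | Dependent k c => exists x, [/\ (k < N)%N,
      forall t, den m mem (c t) (x t),
      col (inord k) V = cols_before V k x &
      forall y, cols_before V k y = 0 -> forall t : 'I_N, (t < k)%N -> y t = 0]
  | Inverse Y => V \in unitmx /\ den_mx mem Y (invmx V)
  end.

Lemma spec_pivot_step mem i u W (uv : 'cV[K]_N) Wv : uv i 0 != 0 ->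
  (forall a, den m mem (u a) (uv a 0)) -> den_mx mem W Wv ->
  spec m mem (pivot_stepC i u W) (N + N * N * 2) 0
    (fun mem' X => den_mx mem' X (pivot_step i uv Wv)).
Proof.
move=> ui du dW; apply: spec_le; [apply: spec_bind| |].
- apply: (@spec_tab _ _ _ _ m _ _ _ (fun l => Wv i l / uv i 0) 1 0) => mem' l p.
  apply: spec_arith; [exact: den_prefix p (dW _ _)|exact: den_prefix p (du _)|].
  by rewrite /= (negPf ui).
- move=> mem1 w p1 dw; apply: (@spec_tab_mx _ _ _ _ _ _ _ _ _ 2 0) => mem' a l p.
  have p' := prefix_trans p1 p; have dw' := den_prefix p (dw l).
  rewrite !mxE big_ord1 !mxE; case: eqP => [->|_].
    rewrite !eqxx mulrBl mulrA mulfV // !mul1r subKr mulrC.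
    by apply: spec_le; first exact: spec_ret.
  rewrite /= subr0 [_^-1 * _]mulrC.
  apply: spec_le; [apply: spec_bind| |].
  + exact: spec_arith (den_prefix p' (du a)) dw' _.
  + move=> mem2 x p2 dx.
    exact: spec_arith (den_prefix p2 (den_prefix p' (dW a l))) dx _.
  + by [].
  + by [].
- by rewrite card_ord muln1.
- by rewrite !muln0.
Qed.

Lemma spec_elim mem X V fuel k s W Wv : (k + fuel = N)%N ->
  den_mx mem X V -> den_mx mem W Wv -> elim_inv V k s Wv ->
  spec m mem (elimC X fuel k s W) (fuel * (6 * (N * N))) 0 (elim_post V).
Proof.
elim: fuel mem k s W Wv => [|fuel IH] mem k s W Wv kf dX dW inv /=.
  apply: spec_ret; rewrite addn0 in kf; rewrite kf in inv.
  have inv1 := elim_inv_inverse inv; have [_ Vu] := mulmx1_unit inv1.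
  split=> // i j; rewrite -[invmx V]mul1mx -inv1 mulmxK // !mxE.
  exact: dW.
have ltk : (k < N)%N by rewrite -kf addnS ltnS leq_addr.
pose u := Wv *m col (inord k) V.
apply: spec_le; [apply: spec_bind| |].
- apply: (@spec_tab _ _ _ _ m _ _ _ (fun i => u i 0) (N * 2) 0) => mem' i p.
  apply: spec_le; [apply: spec_post|rewrite -[N]card_ord; exact: leqnn|].
  + apply: (@spec_sum _ _ _ _ _ _ _ _ (fun l => Wv i l * V l (inord k)) 1 0) => mem'' l p'.
    have p2 := prefix_trans p p'.
    exact: spec_arith (den_prefix p2 (dW _ _)) (den_prefix p2 (dX _ _)) _.
  + move=> mem'' a _.
    have -> // : u i 0 = \sum_l Wv i l * V l (inord k).
    by rewrite mxE; apply: eq_bigr => l _; rewrite mxE.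
  + by rewrite muln0.
- move=> mem1 U p1 dU; apply: spec_bind; first exact: spec_find dU.
  move=> mem2 o p2; have p12 := prefix_trans p1 p2.
  case: o => [i [si ui]|none].
    apply: spec_bind.
      apply: spec_pivot_step ui _ (den_mx_prefix p12 dW) => a.
      exact: den_prefix p2 (dU a).
    move=> mem3 W' p3 dW'; apply: IH dW' _.
    + by rewrite addSnnS.
    + exact: den_mx_prefix (prefix_trans p12 p3) dX.
    + apply: elim_inv_step => // t ltt.
      by move: si; rewrite mem_filter => /andP[/forallP/(_ t)/implyP/(_ ltt)].
  apply: spec_le; first apply: spec_ret.
  + exists (fun t => u (s t) 0); split=> //.
    * by move=> t; apply: den_prefix p2 (dU _).
    * apply: elim_inv_dep inv _ => i H; apply: none.
      rewrite mem_filter mem_enum andbT; apply/forallP => t; apply/implyP.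
      exact: H.
    * by move=> y y0 t; apply: (elim_inv_indep inv y0).
  + exact: leq0n.
  + exact: leq0n.
- rewrite card_ord; have : (size (free_rows k s) <= N)%N.
    by rewrite size_filter (leq_trans (count_size _ _)) // size_enum_ord.
  move: (size _) (leq_pmull N (ltn0Sn n)) => f; rewrite mulnA.
  by move: (N * N)%N (N) => A B; lia.
- by rewrite muln0.
Qed.

Lemma spec_eliminate mem X V : den_mx mem X V ->
  spec m mem (eliminateC X) (6 * (N * N * N)) 0 (elim_post V).
Proof.
move=> dX; apply: spec_le; first apply: spec_elim dX (den_mx_const _ _) _.
- by [].
- by split=> //; apply: unitmx1.
- by move: (N) => B; lia.
- by [].
Qed.

End EliminationProgram.

(** * The diagonalisability tests *)

Section DiagPrograms.
Variables (K : numFieldType) (I : Type) (q : nat) (O : Type) (n : nat).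
Notation N := n.+1.
Notation opd := (operand K I).
Notation cprog := (cprog K I q O).
Variable mulprog : prog K (matmul_input N) 0 'M[operand K (matmul_input N)]_N.

Fixpoint powersC (X : 'M[opd]_N) (k : nat) : cprog (nat -> 'M[opd]_N) :=
  if k is k'.+1 then
    f <- powersC X k'; Y <- mulmxC mulprog X (f k');
    ret (fun i => if i == k then Y else f i)
  else ret (fun=> const_opd I 1%:M).

(** The indices satisfy i + j <= 2n, so powers up to [n + n] suffice. In the dependent case [Q] is
    the value at [X] of the monic polynomial read off from the dependence. *)
Definition hankel_diagC (X : 'M[opd]_N) : cprog bool :=
  f <- powersC X (n + n);
  s <- tabC (fun j : 'I_(n + n).+1 => traceC (f j));
  e <- eliminateC (\matrix_(i, j) s (inord (i + j)));
  if e is Dependent k c then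
    Q <- tab_mxC (fun i j =>
           x <- sumC (fun t : 'I_N =>
                  if (t < k)%N then arithC Mul (c t) (f t i j)
                  else ret (Const 0));
           arithC Defs.Sub (f k i j) x);
    zero_mxC Q
  else ret true.

(** [P] and [P'] hold the values at [X] of two consecutive orthogonal polynomials, and [h'] the norm
    of the earlier one. The sign test is applied to the negated norm [nh], so that it decides
    whether h <= 0. *)
Fixpoint orth_diagC (X : 'M[opd]_N) (fuel : nat) (P P' : 'M[opd]_N)
    (h' : opd) : cprog bool :=
  if fuel is fuel'.+1 then
    z <- zero_mxC P;
    if z then ret true else
    h <- trace_mulC P P;
    nh <- arithC Defs.Sub (Const 0) h;
    b <- nonnegC nh;
    if b then ret false else
    Y <- mulmxC mulprog X P;
    a <- trace_mulC Y P;
    al <- arithC Div a h;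
    be <- arithC Div h h';
    P1 <- tab_mxC (fun i j =>
            x <- arithC Mul al (P i j);
            y <- arithC Mul be (P' i j);
            z <- arithC Defs.Sub (Y i j) x;
            arithC Defs.Sub z y);
    orth_diagC X fuel' P1 P h
  else ret false.

Variables (m : machine K I q) (M : nat).
Hypothesis mulP : computes_matmul (ordered m) mulprog M.

Lemma spec_powers mem X V k : den_mx m mem X V ->
  spec m mem (powersC X k) (k * M) 0
    (fun mem' f => forall i, (i <= k)%N -> den_mx m mem' (f i) (V ^+ i)).
Proof.
elim: k mem => [|k IH] mem dX /=.
  apply: spec_ret => i; rewrite leqn0 => /eqP ->; exact: den_mx_const.
apply: spec_le; [apply: spec_bind| |].
- exact: IH.
- move=> mem1 f p1 df; apply: spec_bind.
    exact (spec_mulmx mulP (den_mx_prefix p1 dX) (df _ (leqnn k))).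
  move=> mem2 Y p2 dY; apply: spec_ret => i; rewrite leq_eqVlt.
  case: eqVneq => [-> _|_ /= ltik]; first by rewrite exprS.
  exact: den_mx_prefix p2 (df _ _).
- by rewrite addn0 mulSn addnC.
- by [].
Qed.

End DiagPrograms.

(** * Moments as products with the Hankel matrix of power traces *)

Section Hankel.
Variables (K : numFieldType) (n : nat) (A : 'M[K]_n.+1).
Notation N := n.+1.

Definition hankel : 'M[K]_N := \matrix_(i, j) \tr (A ^+ (i + j)).

Lemma hankel_moment (g : {poly K}) k (i : 'I_N) : (size g <= k)%N -> (k <= N)%N ->
  \tr (A ^+ i *m horner_mx A g) = cols_before hankel k (fun t => g`_t) i 0.
Proof.
move=> sg lek; have -> : g = \sum_(t < N) g`_t *: 'X^t.
  rewrite -poly_def; apply/polyP => j; rewrite coef_poly; case: ltnP => // leNj.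
  by rewrite nth_default // (leq_trans sg) // (leq_trans lek).
rewrite [in RHS]/cols_before summxE raddf_sum /= mulmx_sumr raddf_sum /=.
rewrite [RHS]big_mkcond /=; apply: eq_bigr => t _.
rewrite linearZ /= rmorphXn /= horner_mx_X -scalemxAr mxtraceZ mulmxE -exprD.
have -> : (\sum_(t0 < N) g`_t0 *: 'X^t0)`_t = g`_t.
  by rewrite -poly_def coef_poly ltn_ord.
case: ltnP => [_|lekt]; first by rewrite !mxE.
by rewrite nth_default ?mul0r // (leq_trans sg).
Qed.

End Hankel.

Section ComplexDiagSpec.
Variables (C : numClosedFieldType) (I : Type) (q : nat) (O : Type) (n : nat).
Notation N := n.+1.
Variable mulprog : prog C (matmul_input N) 0 'M[operand C (matmul_input N)]_N.
Variables (m : machine C I q) (M : nat).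
Hypothesis mulP : computes_matmul (ordered m) mulprog M.

(** If all moments of [g] vanished, its coefficients would be a relation among the first [k] columns
    of the Hankel matrix. *)
Lemma hankel_free_moment (A : 'M[C]_N) (k : nat) (g : {poly C}) : (k <= N)%N ->
  (forall y, cols_before (hankel A) k y = 0 ->
     forall t : 'I_N, (t < k)%N -> y t = 0) ->
  g != 0 -> (size g <= k)%N ->
  exists i : 'I_N, \tr (A ^+ i *m horner_mx A g) != 0.
Proof.
move=> lek free nzg sg; apply/existsP; apply: contraNT nzg => /existsPn H.
rewrite -size_poly_eq0 -leqn0; apply/leq_sizeP => j _.
have [ltjk|] := ltnP j k; last by move=> lekj; rewrite nth_default // (leq_trans sg).
rewrite -[j]/(val (Ordinal (leq_trans ltjk lek))).
apply: (free (fun t => g`_t)) => //; apply/colP => i.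
by rewrite -hankel_moment // mxE; apply/eqP; rewrite -[_ == _]negbK H.
Qed.

Lemma spec_hankel_diag mem X A : den_mx m mem X A ->
  spec m mem (hankel_diagC (O := O) mulprog X) (2 * N * M + 13 * (N * N * N)) 0
    (fun _ b => b = `[< diagonalizable A >]).
Proof.
move=> dX; apply: spec_le; [apply: spec_bind| |].
- exact (spec_powers mulP dX).
- move=> mem1 f p1 df; apply: spec_bind.
    apply: (@spec_tab _ _ _ _ m _ _ _ (fun j => \tr (A ^+ (val j))) N 0) => mem' j p.
    by apply: spec_trace; apply: den_mx_prefix p (df _ _); rewrite -ltnS.
  move=> mem2 s p2 ds; apply: spec_bind.
    apply: (@spec_eliminate _ _ _ _ _ _ _ _ (hankel A)) => i j.
    have ltij : (i + j < (n + n).+1)%N.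
      by have := ltn_ord i; have := ltn_ord j; rewrite !ltnS; lia.
    by rewrite !mxE -[in X in den _ _ _ X](inordK ltij).
  (* An inverse means that the columns are independent, hence that the eigenvalues are distinct. *)
  move=> mem3 [k c|Y] p3 /=; last first.
    case=> Hu _; apply: spec_le; first apply: spec_ret.
    + apply/esym/asboolT/diagonalizable_hankel_free => g nzg sg.
      apply: (@hankel_free_moment A N) => // y y0 t _.
      have : hankel A *m (\col_j y j) = 0.
        rewrite -y0; apply/colP => i; rewrite /cols_before summxE mxE.
        rewrite [RHS]big_mkcond; apply: eq_bigr => l _.
        by rewrite ltn_ord !mxE mulrC.
      move/(congr1 (mulmx (invmx (hankel A)))); rewrite mulKmx // mulmx0.
      by move/colP/(_ t); rewrite !mxE.
    + exact: leq0n.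
    + exact: leq0n.
  case=> x [ltk dc dep free].
  (* With [r] read off from the dependence, [Q] has zero moments. Independence of the earlier
     columns makes its size minimal, as [diagonalizable_hankel_dep] requires. *)
  pose r : {poly C} := \poly_(t < k) x (inord t).
  have sr : (size r <= k)%N by apply: size_poly.
  have rt (t : 'I_N) : (t < k)%N -> r`_t = x t.
    by move=> ltt; rewrite coef_poly ltt inord_val.
  pose Q : {poly C} := 'X^k - r.
  have sQ : size Q = k.+1 by rewrite size_polyDl ?size_polyXn // size_polyN ltnS.
  have QA : horner_mx A Q = A ^+ k - \sum_(t < N) (if (t < k)%N then x t * 1 else 0) *: A ^+ t.
    rewrite rmorphB /= rmorphXn /= horner_mx_X; congr (_ - _).
    have -> : r = \sum_(t < N) (if (t < k)%N then x t * 1 else 0) *: 'X^t.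
      apply/polyP => j; rewrite coef_poly coef_sum.
      have [ltjk|lekj] := ltnP j k.
        have ltjN := ltn_trans ltjk ltk.
        rewrite (bigD1 (Ordinal ltjN)) //= ltjk coefZ coefXn eqxx !mulr1 big1 ?addr0.
          by congr x; apply/val_inj; rewrite /= inordK.
        move=> t tj; rewrite coefZ coefXn; case: eqP => [e|]; last by rewrite mulr0.
        by move: tj; rewrite -val_eqE /= e eqxx.
      rewrite big1 // => t _; case: ifP => [ltt|_]; last by rewrite scale0r coef0.
      by rewrite coefZ coefXn gtn_eqF ?mulr0 // (leq_trans ltt).
    rewrite raddf_sum /=; apply: eq_bigr => t _.
    by rewrite linearZ /= rmorphXn /= horner_mx_X.
  have Qspec : diagonalizable A <-> horner_mx A Q = 0.
    apply: diagonalizable_hankel_dep.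
    - move=> i; rewrite rmorphB /= rmorphXn /= horner_mx_X mulmxBr raddfB /=.
      rewrite (hankel_moment A i sr (ltnW ltk)) mulmxE -exprD.
      have -> : cols_before (hankel A) k (fun t => r`_t) = cols_before (hankel A) k x.
        by apply: eq_bigr => t ltt; rewrite rt.
      by rewrite -dep !mxE inordK // subrr.
    - by rewrite -size_poly_eq0 sQ.
    - rewrite sQ => g nzg; rewrite ltnS => sg.
      exact: hankel_free_moment (ltnW ltk) free nzg sg.
  apply: spec_bind.
    apply: (@spec_tab_mx _ _ _ _ _ _ _ _ (horner_mx A Q) (N * 2 + 1) 0) => mem' i j p'.
    have p3' := prefix_trans p2 (prefix_trans p3 p').
    apply: spec_le; [apply: spec_bind| |].
    + apply: (@spec_sum _ _ _ _ _ _ _ _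
        (fun t : 'I_N => if (t < k)%N then x t * (A ^+ t) i j else 0) 1 0) => mem'' t p''.
      have p4 := prefix_trans p' p''; have p5 := prefix_trans p3' p''.
      case: ifP => ltt.
        apply: spec_arith (den_prefix p4 (dc t)) (den_prefix p5 (df _ _ i j)) _ => //.
        by rewrite (leq_trans (leq_ord t)) // leq_addr.
      apply: spec_le; first by apply: spec_ret; apply: den_const.
      * exact: leq0n.
      * exact: leq0n.
    + move=> mem4 y p4 dy; apply: spec_arith dy _.
        apply: den_prefix (prefix_trans p3' p4) (df _ _ i j).
        by move: ltk; rewrite ltnS => /leq_trans; apply; apply: leq_addr.
      rewrite QA mxE [in RHS]mxE summxE /=; congr (Some (_ - _)).
      by apply: eq_bigr => t _; rewrite mxE; case: ifP; rewrite ?mulr1 ?mul0r.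
    + by rewrite card_ord.
    + by rewrite muln0.
  move=> mem4 Z p4 dZ; apply: spec_post; first exact: spec_zero_mx dZ.
  by move=> mem5 b _ ->; apply/esym/asbool_equiv_eqP; [exact: eqP|].
- rewrite card_ord; nia.
- by rewrite !muln0.
Qed.

End ComplexDiagSpec.

Section RealDiagSpec.
Variables (R : rcfType) (I : Type) (q : nat) (O : Type) (n : nat).
Notation N := n.+1.
Variable mulprog : prog R (matmul_input N) 0 'M[operand R (matmul_input N)]_N.
Variables (m : machine R I q) (M : nat).
Hypothesis mulP : computes_matmul (ordered m) mulprog M.
Hypothesis om : ordered m.

(** Induction on [fuel]: at round [k] the form is positive on degrees below [k], and the round
    either answers or extends this to degree [k]. *)
Lemma spec_orth_diag_loop mem X A fuel k P P' h' (p p' : {poly R}) x' :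
  (k + fuel = N.+1)%N -> den_mx m mem X A ->
  den_mx m mem P (horner_mx A p) -> den_mx m mem P' (horner_mx A p') ->
  den m mem h' x' -> form_pos A k -> orth_poly A k p -> orth_prev A k p' x' ->
  x' != 0 ->
  spec m mem (orth_diagC (O := O) mulprog X fuel P P' h')
    (fuel * (M + 13 * (N * N))) 0 (fun _ b => b = `[< diagonalizable A >]).
Proof.
elim: fuel mem k P P' h' p p' x' => [|fuel IH] mem k P P' h' p p' x' kf
  dX dP dP' dh' pos op prev x'0 /=.
  (* Out of fuel, the form would be positive on degrees up to [N], which the characteristic
     polynomial refutes. *)
  by rewrite addn0 in kf; rewrite kf in pos; case: (form_pos_bound pos).
have trE (g1 g2 : {poly R}) :
    \tr (horner_mx A g1 *m horner_mx A g2) = trace_form A g1 g2.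
  by rewrite /trace_form rmorphM.
apply: spec_le; [apply: spec_bind| |].
- exact (spec_zero_mx dP).
- move=> mem1 _ p1 ->; case: eqP => [pA|/eqP npA].
    apply: spec_le; first apply: spec_ret.
    + exact/esym/asboolT/(orth_poly_accept pos op pA).
    + exact: leq0n.
    + exact: leq0n.
  apply: spec_bind.
    exact (spec_trace_mul (den_mx_prefix p1 dP) (den_mx_prefix p1 dP)).
  move=> mem2 h p2 dh; rewrite trE in dh; have p12 := prefix_trans p1 p2.
  apply: spec_bind.
    exact (spec_arith (op := Defs.Sub) (@den_const _ _ _ m mem2 0) dh erefl).
  move=> mem3 nh p3 dnh; have p13 := prefix_trans p12 p3.
  have dh3 := den_prefix p3 dh.
  apply: spec_bind; first exact (spec_nonneg om dnh).
  move=> mem4 _ p4 ->; have p14 := prefix_trans p13 p4.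
  have dh4 := den_prefix p4 dh3; rewrite sub0r oppr_ge0.
  (* The value of [p] at [A] is nonzero here, so for a diagonalisable [A] its norm would be
     positive. *)
  case: ifP => [hle0|/negbT]; last rewrite -ltNge => hgt0.
    apply: spec_le; first apply: spec_ret.
    + apply/esym/asboolF => dA; have := diagonalizable_form_gt0 dA npA.
      by rewrite ltNge hle0.
    + exact: leq0n.
    + exact: leq0n.
  apply: spec_bind.
    exact (spec_mulmx mulP (den_mx_prefix p14 dX) (den_mx_prefix p14 dP)).
  move=> mem5 Y p5; have p15 := prefix_trans p14 p5.
  have -> : A *m horner_mx A p = horner_mx A ('X * p).
    by rewrite rmorphM /= horner_mx_X.
  move=> dY; have dh5 := den_prefix p5 dh4.
  apply: spec_bind; first exact (spec_trace_mul dY (den_mx_prefix p15 dP)).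
  move=> mem6 a p6; rewrite trE => da; have p16 := prefix_trans p15 p6.
  have dh6 := den_prefix p6 dh5.
  apply: spec_bind.
    by apply: (spec_arith (op := Div) da dh6); rewrite /= gt_eqF.
  move=> mem7 al p7 dal; have p17 := prefix_trans p16 p7.
  have dh7 := den_prefix p7 dh6.
  apply: spec_bind.
    apply: (spec_arith (op := Div) dh7 (den_prefix p17 dh')).
    by rewrite /= (negPf x'0).
  move=> mem8 be p8 dbe; have p18 := prefix_trans p17 p8.
  have dh8 := den_prefix p8 dh7; have dal8 := den_prefix p8 dal.
  have dY8 := den_mx_prefix (prefix_trans p6 (prefix_trans p7 p8)) dY.
  have dP8 := den_mx_prefix p18 dP; have dP'8 := den_mx_prefix p18 dP'.
  have op1 := orth_polyS pos op hgt0 prev x'0.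
  move: dal8 dbe op1; set av := _ / trace_form A p p; set bv := _ / x'.
  set p1' := _ * p - _ => dal8 dbe op1.
  apply: spec_bind.
    apply: (@spec_tab_mx _ _ _ _ _ _ _ _ (horner_mx A p1') 4 0) => mem' i j p'8.
    have E : horner_mx A p1' i j = horner_mx A ('X * p) i j -
        av * horner_mx A p i j - bv * horner_mx A p' i j.
      rewrite /p1' mulrBl mul_polyC !raddfB /= !horner_mxZ.
      rewrite !mxE; reflexivity.
    rewrite E; apply: spec_le; [apply: spec_bind| |].
    + exact (spec_arith (op := Mul) (den_prefix p'8 dal8)
               (den_prefix p'8 (dP8 i j)) erefl).
    + move=> mem9 x p9 dx; have q9 := prefix_trans p'8 p9; apply: spec_bind.
        exact (spec_arith (op := Mul) (den_prefix q9 dbe)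
                 (den_prefix q9 (dP'8 i j)) erefl).
      move=> mem10 y p10 dy; have q10 := prefix_trans q9 p10; apply: spec_bind.
        exact (spec_arith (op := Defs.Sub) (den_prefix q10 (dY8 i j))
                 (den_prefix p10 dx) erefl).
      move=> mem11 z p11 dz.
      exact (spec_arith (op := Defs.Sub) dz (den_prefix p11 dy) erefl).
    + by [].
    + by [].
  move=> mem9 P1 p9 dP1; have p19 := prefix_trans p18 p9.
  apply: IH dP1 (den_mx_prefix p19 dP) (den_prefix p9 dh8) _ op1 _ _.
  + by rewrite addSnnS.
  + exact: den_mx_prefix p19 dX.
  + exact: form_posS pos op hgt0.
  + by split.
  + by rewrite gt_eqF.
- have : (1 <= N * N)%N by [].
  move: (N * N)%N => B; lia.
- by rewrite !muln0.
Qed.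

Lemma spec_orth_diag mem X A : den_mx m mem X A ->
  spec m mem (orth_diagC (O := O) mulprog X N.+1 (const_opd I 1%:M)
                (const_opd I 0) (Const 1))
    (N.+1 * (M + 13 * (N * N))) 0 (fun _ b => b = `[< diagonalizable A >]).
Proof.
move=> dX; apply: (@spec_orth_diag_loop mem X A N.+1 0 _ _ _ 1 0 1) => //.
- rewrite [horner_mx A 1]rmorph1; exact (@den_mx_const _ _ _ _ m mem 1%:M).
- rewrite [horner_mx A 0]rmorph0; exact (@den_mx_const _ _ _ _ m mem 0).
- by move=> g nzg; rewrite leqn0 size_poly_eq0 (negPf nzg).
- split; rewrite ?monic1 ?size_poly1 // => g; rewrite leqn0 size_poly_eq0.
  by move=> /eqP ->; rewrite /trace_form mulr0 rmorph0 linear0.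
- exact: oner_neq0.
Qed.

End RealDiagSpec.

(** * Inversion, commutation and diagonalisability tests on three given slices *)

Section DecideProgram.
Variables (K : numFieldType) (I : Type) (q : nat) (O : Type) (n : nat).
Notation N := n.+1.
Notation opd := (operand K I).
Notation cprog := (cprog K I q O).
Variable mulprog : prog K (matmul_input N) 0 'M[operand K (matmul_input N)]_N.
Variable diagC : 'M[opd]_N -> cprog bool.

Definition commC (X Y : 'M[opd]_N) : cprog bool :=
  Z <- mulmxC mulprog X Y; Z' <- mulmxC mulprog Y X;
  D <- submxC Z Z'; zero_mxC D.

Definition decideC (T1 T2 T3 : 'M[opd]_N) : cprog (outcome opd N) :=
  e <- eliminateC T1;
  if e is Inverse Y then
    X2 <- mulmxC mulprog Y T2; X3 <- mulmxC mulprog Y T3;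
    c <- commC X2 X3;
    if c then b <- diagC X2; ret (Decided T1 T2 T3 Y b)
    else ret (Decided T1 T2 T3 Y false)
  else ret (Singular T1 T2 T3).

Variables (m : machine K I q) (M td : nat).
Hypothesis mulP : computes_matmul (ordered m) mulprog M.
Hypothesis diagP : forall mem X A, den_mx m mem X A ->
  spec m mem (diagC X) td 0 (fun _ b => b = `[< diagonalizable A >]).

Lemma spec_comm mem X Y U V : den_mx m mem X U -> den_mx m mem Y V ->
  spec m mem (commC X Y) (2 * M + 2 * (N * N)) 0
    (fun _ b => b = (U *m V == V *m U)).
Proof.
move=> dX dY; apply: spec_le; [apply: spec_bind| |].
- exact (spec_mulmx mulP dX dY).
- move=> mem1 Z p1 dZ; apply: spec_bind.
    exact (spec_mulmx mulP (den_mx_prefix p1 dY) (den_mx_prefix p1 dX)).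
  move=> mem2 Z' p2 dZ'; apply: spec_bind.
    exact (spec_submx (den_mx_prefix p2 dZ) dZ').
  move=> mem3 D p3 dD; apply: spec_post; first exact (spec_zero_mx dD).
  by move=> mem4 b _; rewrite subr_eq0.
- lia.
- by [].
Qed.

Lemma spec_decide mem T1 T2 T3 V1 V2 V3 :
  den_mx m mem T1 V1 -> den_mx m mem T2 V2 -> den_mx m mem T3 V3 ->
  spec m mem (decideC T1 T2 T3) (8 * (N * N * N) + 4 * M + td) 0
    (fun mem' o => map_outcome (value (input m) mem') o = decide V1 V2 V3).
Proof.
move=> d1 d2 d3; apply: spec_le; [apply: spec_bind| |].
- exact (spec_eliminate d1).
- move=> mem1 [k c|Y] p1 /=.
    case=> x [ltk _ dep _]; apply: spec_le; first apply: spec_ret.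
    + rewrite /decide (negPf (cols_dep_singular ltk dep)) /=.
      by rewrite !(den_mx_map p1 d1, den_mx_map p1 d2, den_mx_map p1 d3).
    + exact: leq0n.
    + exact: leq0n.
  case=> V1u dY; apply: spec_bind.
    exact (spec_mulmx mulP dY (den_mx_prefix p1 d2)).
  move=> mem2 X2 p2 dX2; have p12 := prefix_trans p1 p2; apply: spec_bind.
    exact (spec_mulmx mulP (den_mx_prefix p2 dY) (den_mx_prefix p12 d3)).
  move=> mem3 X3 p3 dX3; have p13 := prefix_trans p12 p3; apply: spec_bind.
    exact (spec_comm (den_mx_prefix p3 dX2) dX3).
  move=> mem4 b p4 ->; have p14 := prefix_trans p13 p4.
  have p24 := prefix_trans p3 p4; have p14' := prefix_trans p2 p24.
  rewrite /decide V1u /=; case: eqP => [cm|ncm]; last first.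
    apply: spec_le; first apply: spec_ret.
    + rewrite asboolF; last by case.
      rewrite /= !(den_mx_map p14 d1, den_mx_map p14 d2, den_mx_map p14 d3).
      by rewrite (den_mx_map p14' dY).
    + exact: leq0n.
    + exact: leq0n.
  apply: spec_bind; first exact (diagP (den_mx_prefix p24 dX2)).
  move=> mem5 b5 p5 ->; have p15 := prefix_trans p14 p5.
  apply: spec_ret.
  rewrite /= !(den_mx_map p15 d1, den_mx_map p15 d2, den_mx_map p15 d3).
  rewrite (den_mx_map (prefix_trans p14' p5) dY); congr Decided.
  by apply/asbool_equiv_eq; split=> [|[]].
- have : (N * N <= N * N * N)%N by rewrite leq_pmulr.
  lia.
- by [].
Qed.

End DecideProgram.

(** * Every entry of the left factor is read *)

Section Touched.
Variables (K : numFieldType) (I : eqType) (q : nat) (O : Type).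

Definition opd_inputs (a : operand K I) : seq I :=
  if a is Input i then [:: i] else [::].

Lemma size_opd_inputs a : (size (opd_inputs a) <= 1)%N.
Proof. by case: a. Qed.

Lemma eq_value_inputs (inp inp' : I -> K) (s : seq I) mem a :
  {subset opd_inputs a <= s} -> {in s, inp' =1 inp} ->
  value inp' mem a = value inp mem a.
Proof. by case: a => //= i si; apply; apply: si; rewrite inE. Qed.

(** Each counted step reads at most two operands, whence the factor 2. The leaf stays unevaluated in
    [r], so an input that occurs only there does not enter [s]. *)
Lemma run_touched inp ord (p : prog K I q O) mem tape r :
  run (Machine inp None ord) p mem tape = Some r ->
  exists2 s : seq I, (size s <= 2 * ops r)%N & forall inp',
    {in s, inp' =1 inp} -> run (Machine inp' None ord) p mem tape = Some r.
Proof.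
elim: p mem tape r => [o|op a b p IH|p IH|v p IH|a p1 IH1 p2 IH2|a p1 IH1 p2 IH2]
  mem tape r //=.
- by move=> [<-]; exists [::].
- case ez: (arith _ _ _) => [z|//].
  case er: (run _ p _ _) => [r'|//] [<-]; have [s ss Hs] := IH _ _ _ er.
  exists (opd_inputs a ++ opd_inputs b ++ s) => [|inp' e].
    have := size_opd_inputs a; have := size_opd_inputs b.
    by rewrite !size_cat /=; lia.
  have -> : value inp' mem a = value inp mem a.
    by apply: eq_value_inputs e => i ia; rewrite !mem_cat ia.
  have -> : value inp' mem b = value inp mem b.
    by apply: eq_value_inputs e => i ib; rewrite !mem_cat ib orbT.
  by rewrite ez Hs // => i si; apply: e; rewrite !mem_cat si !orbT.
- case: tape => // x tape; case er: (run _ p _ _) => [r'|//] [<-].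
  have [s ss Hs] := IH _ _ _ er; exists s => [|inp' e]; first by rewrite /=; lia.
  by rewrite Hs.
- case er: (if _ then _ else _) => [r'|//] [<-].
  have [s ss Hs] : exists2 s : seq I, (size s <= 2 * ops r')%N & forall inp',
      {in s, inp' =1 inp} -> (if value inp mem a == 0
        then run (Machine inp' None ord) p1 mem tape
        else run (Machine inp' None ord) p2 mem tape) = Some r'.
    by case: ifP er => _ /[dup] er; [move/IH1|move/IH2].
  exists (opd_inputs a ++ s) => [|inp' e].
    by have := size_opd_inputs a; rewrite size_cat /=; lia.
  have -> : value inp' mem a = value inp mem a.
    by apply: eq_value_inputs e => i ia; rewrite mem_cat ia.
  by rewrite Hs // => i si; apply: e; rewrite mem_cat si orbT.
- case: ord IH1 IH2 => // IH1 IH2.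
  case er: (if _ then _ else _) => [r'|//] [<-].
  have [s ss Hs] : exists2 s : seq I, (size s <= 2 * ops r')%N & forall inp',
      {in s, inp' =1 inp} -> (if 0 <= value inp mem a
        then run (Machine inp' None true) p1 mem tape
        else run (Machine inp' None true) p2 mem tape) = Some r'.
    by case: ifP er => _ /[dup] er; [move/IH1|move/IH2].
  exists (opd_inputs a ++ s) => [|inp' e].
    by have := size_opd_inputs a; rewrite size_cat /=; lia.
  have -> : value inp' mem a = value inp mem a.
    by apply: eq_value_inputs e => i ia; rewrite mem_cat ia.
  by rewrite Hs // => i si; apply: e; rewrite mem_cat si orbT.
Qed.

End Touched.

(* If the (i, j) entry of the left factor is not read in the run on (0, B), with
   all entries of B equal to 2, then the run on (E_ij, B) is the same; but entry
   (i, j) of the product changes from 0 to 2, which is not an input value. *)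
Lemma matmul_lower_bound (K : numFieldType) ord N P M :
  @computes_matmul K ord N P M -> (N * N <= 2 * M)%N.
Proof.
move=> mulP; pose B : 'M[K]_N := const_mx 2.
have [r [er lr tr]] := mulP 0 B.
have [s ss Hs] := @run_touched K ('I_N * 'I_N + 'I_N * 'I_N)%type _ _ _ _ _ _ _ _ er.
rewrite leqNgt; apply/negP => ltM.
(* Otherwise [s] would contain all N^2 entries of the left factor, more than its length allows. *)
have [[i j] ns] : exists ij, inl ij \notin s.
  apply/existsP; apply: contraTT ltM => /existsPn all_s; rewrite -leqNgt.
  apply: leq_trans (leq_trans ss _); last by rewrite leq_mul2l tr.
  have <- : size [seq (inl ij : 'I_N * 'I_N + 'I_N * 'I_N) | ij <- enum {: 'I_N * 'I_N}] =
      (N * N)%N.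
    by rewrite size_map -cardE card_prod card_ord.
  apply: uniq_leq_size; first by rewrite map_inj_uniq ?enum_uniq // => ? ? [].
  by move=> _ /mapP[ij _ ->]; have := all_s ij; rewrite negbK.
have [r' [er' lr' _]] := mulP (delta_mx i j) B.
move: er'; rewrite /matmul_machine Hs => [[e]|[ij|ij] //= ijs]; last first.
  rewrite !mxE; case: eqP => //= e1; case: eqP => //= e2.
  by move: ns; rewrite -e1 -e2 -surjective_pairing ijs.
have /matrixP/(_ i j) := lr'; have /matrixP/(_ i j) := lr; rewrite -{}e {r' lr' lr}.
have -> : (delta_mx i j *m B) i j = 2.
  rewrite mxE (bigD1 j) //= big1 => [|l lj]; first by rewrite !mxE !eqxx mul1r addr0.
  by rewrite !mxE (negPf lj) andbF mul0r.
have n2 : (2 : K) != 0 by rewrite pnatr_eq0.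
(* The leaf operand must take the value 0 and then 2. A constant or a register is the same in both
   runs, an entry of the left factor is only ever 0 or 1, and an entry of [B] is 2 from the
   start. *)
rewrite mul0mx !mxE; case: (leaf r i j) => [c|[[a b]|[a b]]|l] /=; rewrite ?mxE.
- by move=> -> /esym/eqP; rewrite (negPf n2).
- move=> _; case: (_ && _) => /esym/eqP; last by rewrite (negPf n2).
  by rewrite eqr_nat.
- by move=> /eqP; rewrite (negPf n2).
- by move=> -> /esym/eqP; rewrite (negPf n2).
Qed.

(** * Cubic forms and their symmetric tensors *)

Section Tensor.
Variables (K : numFieldType) (n : nat).
Notation triple := ('I_n * 'I_n * 'I_n)%type.
Implicit Types (f : {mpoly K[n]}) (S : 'I_n -> 'I_n -> 'I_n -> K).

Definition monom3 (i j k : 'I_n) : 'X_{1..n} := (U_(i) + U_(j) + U_(k))%MM.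

Lemma mdeg_monom3 i j k : mdeg (monom3 i j k) == 3.
Proof. by rewrite !mdegD !mdeg1. Qed.

Definition cubic_monom3 i j k : cubic_monom n :=
  exist (fun m => is_true (mdeg m == 3)) _ (mdeg_monom3 i j k).

(** The number of orderings of the three variables: 1, 3 or 6. Dividing by it spreads a coefficient
    evenly over these orderings, which makes the tensor symmetric. *)
Definition monom3_mult (i j k : 'I_n) : K :=
  #|[set p : triple | monom3 p.1.1 p.1.2 p.2 == monom3 i j k]|%:R.

Definition cubic_coef f (i j k : 'I_n) : K :=
  f@_(monom3 i j k) * (monom3_mult i j k)^-1.

Lemma big_triple (V : nmodType) (F : 'I_n -> 'I_n -> 'I_n -> V) :
  \sum_i \sum_j \sum_k F i j k = \sum_(p : triple) F p.1.1 p.1.2 p.2.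
Proof.
by rewrite pair_bigA /= (pair_bigA _ (fun p k => F p.1 p.2 k)).
Qed.

Lemma mdegS_split d (m : 'X_{1..n}) : mdeg m = d.+1 ->
  exists i m', m = (m' + U_(i))%MM /\ mdeg m' = d.
Proof.
move=> dm; have /existsP[i mi] : [exists i, m i != 0%N].
  apply: contraTT isT => /existsPn m0; move: dm; rewrite mdegE big1 // => i _.
  by apply/eqP; have := m0 i; rewrite negbK.
exists i, (m - U_(i))%MM; have e := submK (etrans (lep1mP i m) mi).
split; first by rewrite e.
by move: dm; rewrite -{1}e mdegD mdeg1 addn1 => -[].
Qed.

Lemma mdeg3_monom3 (m : 'X_{1..n}) : mdeg m = 3 -> exists i j k, m = monom3 i j k.
Proof.
move=> /mdegS_split[k [m2 [-> /mdegS_split[j [m1 [-> /mdegS_split[i [m0 [-> dm0]]]]]]]]].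
exists i, j, k; move/eqP: dm0; rewrite mdeg_eq0 => /eqP ->.
by rewrite add0m.
Qed.

Lemma cubic_coef_sym f : symmetric_tensor (cubic_coef f).
Proof.
move=> i j k; rewrite /cubic_coef /monom3_mult.
have -> : monom3 j i k = monom3 i j k by rewrite /monom3 (addmC U_(j)%MM).
have -> : monom3 i k j = monom3 i j k by rewrite /monom3 -!addmA (addmC U_(k)%MM).
by [].
Qed.

Lemma cubic_coefE f : f \is 3.-homog ->
  f = \sum_(p : triple) cubic_coef f p.1.1 p.1.2 p.2 *:
        ('X_p.1.1 * 'X_p.1.2 * 'X_p.2).
Proof.
move=> hf; apply/mpolyP => m; rewrite raddf_sum /=.
pose E := [set p : triple | monom3 p.1.1 p.1.2 p.2 == m].
rewrite (bigID (mem E)) /= [X in _ + X]big1 ?addr0 => [|p]; last first.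
  by rewrite inE => /negPf ne; rewrite mcoeffZ -!mpolyXD mcoeffX ne mulr0.
rewrite (eq_bigr (fun=> f@_m * #|E|%:R^-1)) => [|p]; last first.
  rewrite inE => /eqP pm.
  rewrite mcoeffZ -!mpolyXD mcoeffX -/(monom3 _ _ _) pm eqxx mulr1.
  by rewrite /cubic_coef /monom3_mult pm.
rewrite sumr_const.
have [md|md] := eqVneq (mdeg m) 3; last first.
  by rewrite (dhomog_nemf_coeff hf) // mul0r mul0rn.
(* The coefficient divided by the size of [E] is counted once for each element of [E], which is
   nonempty because [m] has degree 3. *)
rewrite -[RHS]mulr_natr mulfVK // pnatr_eq0 -lt0n; apply/card_gt0P.
have [i [j [k e]]] := mdeg3_monom3 md.
by exists (i, j, k); rewrite inE e.
Qed.

Definition trilin S (u v w : 'I_n -> K) : K :=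
  \sum_(p : triple) S p.1.1 p.1.2 p.2 * (u p.1.1 * v p.1.2 * w p.2).

Lemma trilinC12 S u v w : symmetric_tensor S -> trilin S u v w = trilin S v u w.
Proof.
move=> symS; rewrite /trilin (reindex_inj (h := fun p : triple => (p.1.2, p.1.1, p.2))) /=.
  by apply: eq_bigr => p _; rewrite (symS p.1.2 p.1.1 p.2).1 (mulrC (v _)).
by move=> [[a b] c] [[a' b'] c'] /= [-> -> ->].
Qed.

Lemma trilinC23 S u v w : symmetric_tensor S -> trilin S u v w = trilin S u w v.
Proof.
move=> symS; rewrite /trilin (reindex_inj (h := fun p : triple => (p.1.1, p.2, p.1.2))) /=.
  by apply: eq_bigr => p _; rewrite (symS p.1.1 p.2 p.1.2).2 mulrAC.
by move=> [[a b] c] [[a' b'] c'] /= [-> -> ->].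
Qed.

(** The signed sum keeps only the terms odd in both [v] and [w]: each of the six orderings of [u],
    [v], [w], four times, whence 24. *)
Lemma trilin_polar S u v w : symmetric_tensor S ->
  let cube x := trilin S x x x in
  trilin S u v w =
    (cube (fun i => u i + v i + w i) + cube (fun i => u i - v i - w i) -
     (cube (fun i => u i + v i - w i) + cube (fun i => u i - v i + w i))) * 24^-1.
Proof.
move=> symS cube; set rhs := (_ - _).
suff -> : rhs = trilin S u v w * 24 by rewrite mulfK // pnatr_eq0.
have -> : rhs = (trilin S u v w + trilin S v u w + trilin S u w v +
    trilin S v w u + trilin S w u v + trilin S w v u) * 4.
  rewrite /rhs /cube /trilin -!big_split /= -sumrB mulr_suml.
  by apply: eq_bigr => p _; ring.
have e1 : trilin S v u w = trilin S u v w by rewrite trilinC12.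
have e2 : trilin S u w v = trilin S u v w by rewrite trilinC23.
have e3 : trilin S v w u = trilin S u v w by rewrite trilinC23.
have e4 : trilin S w u v = trilin S u v w by rewrite trilinC12.
have e5 : trilin S w v u = trilin S u v w by rewrite trilinC12.
by rewrite e5 e4 e3 e2 e1; ring.
Qed.

Lemma meval_cubic f (v : 'I_n -> K) : f \is 3.-homog ->
  f.@[v] = trilin (cubic_coef f) v v v.
Proof.
move=> hf; rewrite {1}(cubic_coefE hf) raddf_sum /=; apply: eq_bigr => p _.
by rewrite mevalZ !mevalM !mevalXU.
Qed.

Definition subst_tensor f (A : 'M[K]_n) (a b c : 'I_n) : K :=
  trilin (cubic_coef f) (A^~ a) (A^~ b) (A^~ c).

Lemma tensor_of_lin_subst f A : f \is 3.-homog ->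
  tensor_of (lin_subst f A) (subst_tensor f A).
Proof.
move=> hf; have symf := cubic_coef_sym f; split=> [a b c|].
  by split; [apply: trilinC12 | apply: trilinC23].
rewrite big_triple /lin_subst {1}(cubic_coefE hf) raddf_sum /=.
transitivity (\sum_(p : triple) \sum_(s : triple)
    (cubic_coef f p.1.1 p.1.2 p.2 *
      (A p.1.1 s.1.1 * A p.1.2 s.1.2 * A p.2 s.2)) *:
    ('X_s.1.1 * 'X_s.1.2 * 'X_s.2 : {mpoly K[n]})).
  apply: eq_bigr => p _; rewrite comp_mpolyZ !rmorphM /= !comp_mpolyXU.
  rewrite -!tnth_nth !tnth_mktuple big_distrlr /= pair_bigA /= big_distrlr /=.
  rewrite pair_bigA /= scaler_sumr; apply: eq_bigr => s _.
  by rewrite -!mul_mpolyC !mpolyCM; ring.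
rewrite exchange_big; apply: eq_bigr => s _.
by rewrite /subst_tensor /trilin scaler_suml.
Qed.

(** This form reduces a slice to a linear combination of the slices of [f], in O(N^3) operations,
    and two matrix products. *)
Lemma slice_subst_tensor f A k :
  slice (subst_tensor f A) k =
    A^T *m (\matrix_(i, j) \sum_l A l k * (f@_(monom3 i j l) * (monom3_mult i j l)^-1)) *m A.
Proof.
apply/matrixP => a b; rewrite !mxE /subst_tensor /trilin.
rewrite -(big_triple (fun i j l => cubic_coef f i j l * (A i a * A j b * A l k))).
rewrite exchange_big; apply: eq_bigr => j _; rewrite !mxE mulr_suml.
apply: eq_bigr => i _; rewrite !mxE mulr_sumr mulr_suml.
by apply: eq_bigr => l _; rewrite /cubic_coef; ring.
Qed.

End Tensor.

(** * The algorithm *)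

Section Algorithm.
Variables (K : numFieldType) (I : Type) (n : nat).
Notation N := n.+1.
Notation opd := (operand K I).
Notation cprog := (cprog K I N (outcome opd N)).
Variable mulprog : prog K (matmul_input N) 0 'M[operand K (matmul_input N)]_N.
Variables (sliceC : 'M[opd]_N -> 'I_N -> cprog 'M[opd]_N)
  (diagC : 'M[opd]_N -> cprog bool).
Variable n_ge3 : (3 <= N)%N.

Fixpoint sample_prog (k : nat) (p : prog K I N (outcome opd N)) :=
  if k is k'.+1 then Sample (sample_prog k' p) else p.

(** The position in the enumeration that also orders [sample_tape]: the samples are drawn first, so
    register numbers coincide with tape positions. *)
Definition entry_index (i j : 'I_N) : nat :=
  index (i, j) [seq (i, j) | i <- enum 'I_N, j <- enum 'I_N].

Definition sample_mx : 'M[opd]_N := \matrix_(i, j) Reg (entry_index i j).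

Definition main_prog : prog K I N (outcome opd N) :=
  sample_prog (N * N)
    ((T1 <- sliceC sample_mx (widen_ord n_ge3 (@Ordinal 3 0 isT));
      T2 <- sliceC sample_mx (widen_ord n_ge3 (@Ordinal 3 1 isT));
      T3 <- sliceC sample_mx (widen_ord n_ge3 (@Ordinal 3 2 isT));
      decideC mulprog diagC T1 T2 T3) (N * N)%N (fun _ o => Return _ _ _ o)).

Lemma ok_sample m p mem tape t c Q : ok m p (mem ++ tape) [::] t c Q ->
  ok m (sample_prog (size tape) p) mem tape (size tape + t) c Q.
Proof.
elim: tape mem => [|x tape IH] mem /=; first by rewrite cats0.
rewrite -cat_rcons => /IH H.
by apply: (ok_charge (o := 1) (c := 0) _ H).
Qed.

Lemma size_sample_tape (A : 'M[K]_N) : size (sample_tape A) = (N * N)%N.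
Proof. by rewrite size_allpairs size_enum_ord. Qed.

Lemma den_sample_mx (m : machine K I N) (A : 'M[K]_N) : den_mx m (sample_tape A) sample_mx A.
Proof.
move=> i j; rewrite mxE.
have lti : (entry_index i j < size (sample_tape A))%N.
  rewrite size_allpairs -[(_ * _)%N](size_allpairs pair) index_mem.
  by apply/allpairsP; exists (i, j); rewrite /= !mem_enum.
suff -> : A i j = nth 0 (sample_tape A) (entry_index i j).
  exact: (@den_reg _ _ _ m [::] (sample_tape A) _ lti).
rewrite /sample_tape.
have -> : [seq A i j | i <- enum 'I_N, j <- enum 'I_N] =
    [seq A ij.1 ij.2 | ij <- [seq (i, j) | i <- enum 'I_N, j <- enum 'I_N]].
  by rewrite map_allpairs.
rewrite (nth_map (i, j)) ?nth_index //; last rewrite index_mem;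
  by apply/allpairsP; exists (i, j); rewrite /= !mem_enum.
Qed.

Variables (ord : bool) (inp : {mpoly K[N]} -> I -> K)
  (orc : {mpoly K[N]} -> option ('rV[K]_N -> K)) (M ts cs td : nat).
Let mach f := Machine (inp f) (orc f) ord.
Hypothesis mulP : computes_matmul ord mulprog M.
Hypothesis sliceP : forall f, f \is 3.-homog -> forall mem X A k,
  den_mx (mach f) mem X A ->
  spec (mach f) mem (sliceC X k) ts cs
    (fun mem' Y => den_mx (mach f) mem' Y (slice (subst_tensor f A) k)).
Hypothesis diagP : forall f mem X A, den_mx (mach f) mem X A ->
  spec (mach f) mem (diagC X) td 0 (fun _ b => b = `[< diagonalizable A >]).

Lemma implements_main (R : realType) (t : R) (c : nat) :
  (N * N + (3 * ts + (8 * (N * N * N) + 4 * M + td)))%:R <= t ->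
  (3 * cs <= c)%N -> implements n_ge3 ord inp orc main_prog t c.
Proof.
move=> le_t le_c f hf S A _.
pose V k := slice (subst_tensor f A) (widen_ord n_ge3 k).
have [r [er Qr tr cr]] : ok (mach f) main_prog [::] (sample_tape A)
    (N * N + (3 * ts + (8 * (N * N * N) + 4 * M + td))) (3 * cs)
    (fun mem o => map_outcome (value (inp f) mem) o =
       decide (V (@Ordinal 3 0 isT)) (V (@Ordinal 3 1 isT)) (V (@Ordinal 3 2 isT))).
  have dA := @den_sample_mx (mach f) A.
  have sp : spec (mach f) (sample_tape A)
      (T1 <- sliceC sample_mx (widen_ord n_ge3 (@Ordinal 3 0 isT));
       T2 <- sliceC sample_mx (widen_ord n_ge3 (@Ordinal 3 1 isT));
       T3 <- sliceC sample_mx (widen_ord n_ge3 (@Ordinal 3 2 isT));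
       decideC mulprog diagC T1 T2 T3)
      (3 * ts + (8 * (N * N * N) + 4 * M + td)) (3 * cs)
      (fun mem o => map_outcome (value (inp f) mem) o =
         decide (V (@Ordinal 3 0 isT)) (V (@Ordinal 3 1 isT)) (V (@Ordinal 3 2 isT))).
    apply: spec_le; [apply: spec_bind| |].
    - exact (sliceP hf dA).
    - move=> mem1 T1 p1 d1; apply: spec_bind.
        exact (sliceP hf (den_mx_prefix p1 dA)).
      move=> mem2 T2 p2 d2; apply: spec_bind.
        exact (sliceP hf (den_mx_prefix (prefix_trans p1 p2) dA)).
      move=> mem3 T3 p3 d3; apply: (spec_decide (m := mach f) mulP (@diagP f)).
      + exact: den_mx_prefix (prefix_trans p2 p3) d1.
      + exact: den_mx_prefix p3 d2.
      + exact: d3.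
    - lia.
    - lia.
  have := spec_ok [::] sp; rewrite size_sample_tape => ok1.
  by have := ok_sample (mem := [::]) ok1; rewrite size_sample_tape.
exists r; split=> //.
- by exists (subst_tensor f A); [apply: tensor_of_lin_subst | apply: Qr].
- by apply: le_trans le_t; rewrite ler_nat.
- exact: leq_trans cr le_c.
Qed.

End Algorithm.

(** * Slices from the coefficients of the form *)

Section DenseSlice.
Variables (K : numFieldType) (n : nat) (O : Type).
Notation N := n.+1.
Notation I := (cubic_monom N).
Notation opd := (operand K I).
Notation cprog := (cprog K I N O).
Variable mulprog : prog K (matmul_input N) 0 'M[operand K (matmul_input N)]_N.

Definition dense_sliceC (X : 'M[opd]_N) (k : 'I_N) : cprog 'M[opd]_N :=
  G <- tab_mxC (fun i j => sumC (fun l =>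
         x <- arithC Mul (Input (cubic_monom3 i j l))
                         (Const (monom3_mult K i j l)^-1);
         arithC Mul (X l k) x));
  Y <- mulmxC mulprog X^T G; mulmxC mulprog Y X.

Lemma spec_dense_slice ord M f mem X A k :
  computes_matmul ord mulprog M ->
  let m := Machine (dense_input f) None ord in den_mx m mem X A ->
  spec m mem (dense_sliceC X k) (3 * (N * N * N) + 2 * M) 0
    (fun mem' Y => den_mx m mem' Y (slice (subst_tensor f A) k)).
Proof.
move=> mulP m dX; rewrite slice_subst_tensor; set G := \matrix_(i, j) _.
have dXT : den_mx m mem X^T A^T by move=> i j; rewrite !mxE; apply: dX.
apply: spec_le; [apply: spec_bind| |].
- apply: (@spec_tab_mx _ _ _ _ _ _ _ _ G (N * 3) 0) => mem' i j p.
  rewrite mxE; apply: spec_le; first apply: (@spec_sum _ _ _ _ _ _ _ _ _ 2 0).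
  + move=> mem'' l p'; have p2 := prefix_trans p p'.
    apply: spec_le; [apply: spec_bind| |].
    * apply: (spec_arith (op := Mul)); [exact: den_input|exact: den_const|reflexivity].
    * move=> mem3 x p3 dx.
      exact (spec_arith (op := Mul) (den_prefix (prefix_trans p2 p3) (dX l k)) dx erefl).
    * by [].
    * by [].
  + by rewrite card_ord.
  + by rewrite muln0.
- move=> mem1 G' p1 dG; apply: spec_bind.
    exact (spec_mulmx (m := m) mulP (den_mx_prefix p1 dXT) dG).
  move=> mem2 Y p2 dY.
  exact (spec_mulmx (m := m) mulP dY (den_mx_prefix (prefix_trans p1 p2) dX)).
- lia.
- by rewrite muln0.
Qed.

End DenseSlice.

(** * Slices from values of the form, by polarization *)

Section BlackboxSlice.
Variables (K : numFieldType) (n : nat) (O : Type).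
Notation N := n.+1.
Notation opd := (operand K void).
Notation cprog := (cprog K void N O).

Definition addvC op (u v : 'I_N -> opd) : cprog ('I_N -> opd) :=
  tabC (fun i => arithC op (u i) (v i)).

Definition polarC (u v w : 'I_N -> opd) : cprog opd :=
  s <- addvC Add u v; d <- addvC Defs.Sub u v;
  v1 <- addvC Add s w; v2 <- addvC Defs.Sub d w;
  v3 <- addvC Defs.Sub s w; v4 <- addvC Add d w;
  q1 <- queryC (\row_i v1 i); q2 <- queryC (\row_i v2 i);
  q3 <- queryC (\row_i v3 i); q4 <- queryC (\row_i v4 i);
  x <- arithC Add q1 q2; y <- arithC Add q3 q4;
  z <- arithC Defs.Sub x y; arithC Mul z (Const 24^-1).

Definition blackbox_sliceC (X : 'M[opd]_N) (k : 'I_N) : cprog 'M[opd]_N :=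
  tab_mxC (fun a b => polarC (X^~ a) (X^~ b) (X^~ k)).

Section Spec.
Variables (ord : bool) (f : {mpoly K[N]}).
Hypothesis hf : f \is 3.-homog.
Let m := Machine (no_input f) (Some (blackbox f)) ord.

Lemma spec_addv mem op (u v : 'I_N -> opd) (x y z : 'I_N -> K) :
  (forall i, den m mem (u i) (x i)) -> (forall i, den m mem (v i) (y i)) ->
  (forall i, arith op (x i) (y i) = Some (z i)) ->
  spec m mem (addvC op u v) N 0 (fun mem' r => forall i, den m mem' (r i) (z i)).
Proof.
move=> du dv e; apply: spec_le; first apply: (@spec_tab _ _ _ _ m _ _ _ z 1 0).
- move=> mem' i p.
  exact (spec_arith (den_prefix p (du i)) (den_prefix p (dv i)) (e i)).
- by rewrite card_ord muln1.
- by rewrite muln0.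
Qed.

Lemma spec_blackbox mem (v : 'I_N -> opd) (x : 'I_N -> K) :
  (forall i, den m mem (v i) (x i)) ->
  spec m mem (queryC (O := O) (\row_i v i)) 0 1
    (fun mem' r => den m mem' r (trilin (cubic_coef f) x x x)).
Proof.
move=> dv; have -> : trilin (cubic_coef f) x x x = blackbox f (\row_i x i).
  rewrite /blackbox meval_cubic //; congr trilin;
    by apply/funext => i; rewrite mxE.
by apply: spec_query => // i; rewrite !mxE.
Qed.

Lemma spec_polar mem (u v w : 'I_N -> opd) (x y z : 'I_N -> K) :
  (forall i, den m mem (u i) (x i)) -> (forall i, den m mem (v i) (y i)) ->
  (forall i, den m mem (w i) (z i)) ->
  spec m mem (polarC u v w) (6 * N + 4) 4
    (fun mem' a => den m mem' a (trilin (cubic_coef f) x y z)).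
Proof.
move=> du dv dw; rewrite (trilin_polar _ _ _ (cubic_coef_sym f)).
apply: spec_le; [apply: spec_bind| |].
- exact (spec_addv (op := Add) du dv (fun=> erefl)).
- move=> mem1 s p1 ds; apply: spec_bind.
    exact (spec_addv (op := Defs.Sub) (fun i => den_prefix p1 (du i))
             (fun i => den_prefix p1 (dv i)) (fun=> erefl)).
  move=> mem2 d p2 dd; have p12 := prefix_trans p1 p2.
  have ds2 i := den_prefix p2 (ds i); have dw2 i := den_prefix p12 (dw i).
  apply: spec_bind; first exact (spec_addv (op := Add) ds2 dw2 (fun=> erefl)).
  move=> mem3 v1 p3 d1; apply: spec_bind.
    exact (spec_addv (op := Defs.Sub) (fun i => den_prefix p3 (dd i))
             (fun i => den_prefix p3 (dw2 i)) (fun=> erefl)).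
  move=> mem4 v2 p4 d2; have p34 := prefix_trans p3 p4; apply: spec_bind.
    exact (spec_addv (op := Defs.Sub) (fun i => den_prefix p34 (ds2 i))
             (fun i => den_prefix p34 (dw2 i)) (fun=> erefl)).
  move=> mem5 v3 p5 d3; have p35 := prefix_trans p34 p5; apply: spec_bind.
    exact (spec_addv (op := Add) (fun i => den_prefix p35 (dd i))
             (fun i => den_prefix p35 (dw2 i)) (fun=> erefl)).
  move=> mem6 v4 p6 d4; have p56 := prefix_trans p5 p6.
  have p46 := prefix_trans p4 p56; apply: spec_bind.
    exact (spec_blackbox (fun i => den_prefix p46 (d1 i))).
  move=> mem7 q1 p7 e1; apply: spec_bind.
    exact (spec_blackbox (fun i => den_prefix (prefix_trans p56 p7) (d2 i))).
  move=> mem8 q2 p8 e2; have p78 := prefix_trans p7 p8; apply: spec_bind.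
    exact (spec_blackbox (fun i => den_prefix (prefix_trans p6 p78) (d3 i))).
  move=> mem9 q3 p9 e3; apply: spec_bind.
    exact (spec_blackbox (fun i => den_prefix (prefix_trans p78 p9) (d4 i))).
  move=> mem10 q4 p10 e4; have p910 := prefix_trans p9 p10; apply: spec_bind.
    exact (spec_arith (op := Add) (den_prefix (prefix_trans p8 p910) e1)
             (den_prefix p910 e2) erefl).
  move=> mem11 a p11 da; apply: spec_bind.
    exact (spec_arith (op := Add) (den_prefix (prefix_trans p10 p11) e3)
             (den_prefix p11 e4) erefl).
  move=> mem12 b p12' db; apply: spec_bind.
    exact (spec_arith (op := Defs.Sub) (den_prefix p12' da) db erefl).
  move=> mem13 c p13 dc.
  exact (spec_arith (op := Mul) dc (@den_const _ _ _ m mem13 24^-1) erefl).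
- lia.
- by [].
Qed.

Lemma spec_blackbox_slice mem X A k : den_mx m mem X A ->
  spec m mem (blackbox_sliceC X k) (N * N * (6 * N + 4)) (N * N * 4)
    (fun mem' Y => den_mx m mem' Y (slice (subst_tensor f A) k)).
Proof.
move=> dX; apply: spec_tab_mx => mem' a b p; rewrite mxE.
by apply: spec_polar => i; apply: den_prefix p (dX i _).
Qed.

End Spec.
End BlackboxSlice.

(** A common interface for the two tests. The bound fits both, since [n.+2 <= 2 * n.+1] absorbs the
    extra round of the real one. *)
Definition diag_testable (K : numFieldType) (ord : bool) : Prop :=
  forall (I : Type) (q n : nat) (O : Type)
    (mulprog : prog K (matmul_input n.+1) 0 'M[operand K (matmul_input n.+1)]_n.+1),
  exists diagC : 'M[operand K I]_n.+1 -> cprog K I q O bool,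
  forall (m : machine K I q) M, ordered m = ord ->
    computes_matmul ord mulprog M ->
    forall mem X A, den_mx m mem X A ->
    spec m mem (diagC X) (2 * n.+1 * M + 26 * (n.+1 * n.+1 * n.+1)) 0
      (fun _ b => b = `[< diagonalizable A >]).

Lemma diag_testable_closed (C : numClosedFieldType) : diag_testable C false.
Proof.
move=> I q n O mulprog; exists (hankel_diagC mulprog) => m M om mulP mem X A dX.
rewrite -om in mulP; apply: spec_le; first exact (spec_hankel_diag mulP dX).
- lia.
- by [].
Qed.

Lemma diag_testable_real (R : rcfType) : diag_testable R true.
Proof.
move=> I q n O mulprog.
exists (fun X => orth_diagC mulprog X n.+2 (const_opd I 1%:M) (const_opd I 0) (Const 1)).
move=> m M om mulP mem X A dX; rewrite -om in mulP.
apply: spec_le; first exact (spec_orth_diag mulP om dX).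
- nia.
- by [].
Qed.

(** Truncating the real bound gives a natural number [M] valid for all pairs of factors. The case of
    size 1, where the power is 1, shows that the constant is nonnegative. *)
Lemma feasible_matmul (R : realType) (K : numFieldType) ord (w : R) :
  feasible_exponent K ord w ->
  exists2 C : R, 0 <= C & forall n : nat, exists P M,
    @computes_matmul K ord n.+1 P M /\ M%:R <= C * powR n.+1%:R w :> R.
Proof.
case=> C HC; exists C.
  have [P HP] := HC 1%N; have [r [_ _]] := HP 0 0.
  by rewrite powR1 mulr1; apply: le_trans.
move=> n; have [P HP] := HC n.+1; exists P, (Num.truncn (C * powR n.+1%:R w)).
have [r [_ _ tr]] := HP 0 0; have C0 := le_trans (ler0n _ _) tr.
split; last by rewrite truncn_le.
move=> A B m; have [r' [er lr {}tr]] := HP A B; exists r'; split=> //.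
by rewrite truncn_ge_nat.
Qed.

Lemma feasible_implements (R : realType) (K : numFieldType) ord (w : R) :
  feasible_exponent K ord w -> diag_testable K ord ->
  (exists C : R, forall (n : nat) (n_ge3 : (3 <= n)%N),
     exists P, implements n_ge3 ord (@dense_input K n) (fun=> None) P
       (C * powR n%:R (w + 1)) 0)
  /\
  (exists (C : R) (D : nat), forall (n : nat) (n_ge3 : (3 <= n)%N),
     exists P, implements n_ge3 ord (@no_input K n)
       (fun f => Some (blackbox f)) P (C * powR n%:R (w + 1)) (D * n ^ 2)).
Proof.
move=> /feasible_matmul[C C0 mulC] diagC.
(* The lower bound on [M] gives N^3 <= 2 N M, so 50 N M + 75 N^3 <= 200 N M; the remaining factor N
   raises the exponent by 1. *)
have bound n M t : (n.+1 * n.+1 <= 2 * M)%N -> M%:R <= C * powR n.+1%:R w ->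
    (t <= 50 * (n.+1 * M) + 75 * (n.+1 * n.+1 * n.+1))%N ->
    t%:R <= 200 * C * powR n.+1%:R (w + 1).
  move=> lbM ubM let'; have tM : (t <= 200 * (n.+1 * M))%N.
    apply: leq_trans let' _.
    have : (n.+1 * n.+1 * n.+1 <= 2 * (n.+1 * M))%N.
      by rewrite -mulnA mulnCA leq_mul2l lbM orbT.
    lia.
  rewrite powRD; last by rewrite pnatr_eq0 implybT.
  rewrite powRr1 // -mulrA mulrA.
  have : (n.+1 * M)%:R <= C * powR n.+1%:R w * n.+1%:R.
    by rewrite natrM mulrC ler_wpM2r.
  move=> H; apply: le_trans (_ : (200 * (n.+1 * M))%:R <= _).
    by rewrite ler_nat.
  by rewrite natrM -!mulrA ler_wpM2l // mulrA.
split.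
  exists (200 * C) => -[//|n] n_ge3; have [P [M [mulP ubM]]] := mulC n.
  have lbM := matmul_lower_bound mulP.
  have [dC dP] := diagC (cubic_monom n.+1) n.+1 n
    (outcome (operand K (cubic_monom n.+1)) n.+1) P.
  exists (main_prog P (dense_sliceC P) dC n_ge3).
  apply: (implements_main n_ge3 mulP).
  - by move=> f _ mem X A k; apply: spec_dense_slice mulP.
  - by move=> f mem X A; apply: (dP _ M).
  - apply: bound lbM ubM _; nia.
  - by [].
(* Three slices of N^2 entries, with four oracle calls per entry. *)
exists (200 * C), 12%N => -[//|n] n_ge3; have [P [M [mulP ubM]]] := mulC n.
have lbM := matmul_lower_bound mulP.
have [dC dP] := diagC void n.+1 n (outcome (operand K void) n.+1) P.
exists (main_prog P (@blackbox_sliceC _ _ _) dC n_ge3).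
apply: (implements_main n_ge3 mulP).
- by move=> f hf mem X A k; apply: spec_blackbox_slice.
- by move=> f mem X A; apply: (dP _ M).
- apply: bound lbM ubM _; nia.
- by rewrite -mulnn; lia.
Qed.

Theorem theoremA3 (R : realType) (k : ground) (w : R)
    (hw : feasible_exponent (ground_field R k) (ground_ordered k) w) :
  (exists C : R, forall (n : nat) (n_ge3 : (3 <= n)%N),
     exists P, implements n_ge3 (ground_ordered k)
       (@dense_input (ground_field R k) n) (fun=> None) P
       (C * powR n%:R (w + 1)) 0)
  /\
  (exists (C : R) (D : nat), forall (n : nat) (n_ge3 : (3 <= n)%N),
     exists P, implements n_ge3 (ground_ordered k)
       (@no_input (ground_field R k) n) (fun f => Some (blackbox f)) P
       (C * powR n%:R (w + 1)) (D * n ^ 2)).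
Proof.
apply: feasible_implements hw _; case: k => /=.
  exact: diag_testable_real.
exact: diag_testable_closed.
Qed.
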